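(* Let $I$ be an arbitrary set. There exist a Hilbert space $\mathcal{H}$ and a closed subspace $E$ of $B(\mathcal{H})$ which is isometric (as a Banach space) to $\ell_2(I)$ and such that the natural linear identification $E\to\overline{E^*}$ is a complete isometry. Moreover, this space is unique up to complete isometry: any two operator spaces which are isometric to $\ell_2(I)$ and whose natural identification with their antidual is a complete isometry are completely isometric to each other.
   Context: All spaces are complex. An operator space is a Banach space $E$ given with an isometric embedding as a closed subspace of $B(H)$, the bounded operators on some Hilbert space $H$. Then $M_n(E)$ ($n\times n$ matrices with entries in $E$) is normed as a subspace of $M_n(B(H))=B(H\oplus\cdots\oplus H)$ ($n$ summands). For linear $u:E\to F$ between operator spaces, $\|u\|_{cb}=\sup_n\|(a_{ij})\mapsto(u(a_{ij}))\|_{M_n(E)\to M_n(F)}$; $u$ is completely bounded (c.b.) if this is finite, and $cb(E,F)$ is the space of such maps with this norm. $u$ is a complete isometry if all the maps $M_n(E)\to M_n(F)$, $(a_{ij})\mapsto (u(a_{ij}))$, are isometric; $E$ and $F$ are completely isometric if there is a surjective linear complete isometry between them. The dual $E^*$ is an operator space with $M_n(E^* )=cb(E,M_n)$ (isometrically). The complex conjugate $\overline{E}$ is the same Banach space with scalar multiplication $\lambda\cdot x=\overline{\lambda}x$, with operator space structure induced by $\overline{E}\subset\overline{B(H)}=B(\overline{H})$. The antidual of $E$ is $\overline{E^*}$. If $E$ is isometric to a Hilbert space with inner product $\langle\cdot,\cdot\rangle$ (linear in the first variable), the natural linear identification $E\to\overline{E^*}$ sends $x$ to the functional $y\mapsto\langle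 y,x\rangle$, viewed as an element of $\overline{E^*}$. *)

(* Defs.v *)
From HB Require Import structures.
From mathcomp Require Import all_boot all_order all_algebra.
From mathcomp Require Import sesquilinear complex.
From mathcomp Require Import all_classical all_reals all_analysis.

Set Implicit Arguments.
Unset Strict Implicit.
Unset Printing Implicit Defensive.

Import Order.TTheory GRing.Theory Num.Theory.
Import numFieldNormedType.Exports.

Local Open Scope classical_set_scope.
Local Open Scope ring_scope.

(* The norm of a complex normed space takes its values in [R[i]]; [nrm] is the
   same norm with values in [R]. *)
Definition nrm (R : realType) (V : normedZmodType R[i]) (x : V) : R :=
  complex.Re `|x|.

Section BoundedLinear.
Variables (R : realType) (V W : normedModType R[i]).

Definition bounded_linear : {pred V -> W} := fun f : V -> W =>
  `[< linear f /\ exists M : R[i], forall x, `|f x| <= M * `|x| >].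

Record bdlin := BdLin { bdfun :> V -> W ; bdfunP : bdfun \in bounded_linear }.

HB.instance Definition _ := [isSub for bdfun].
HB.instance Definition _ := [Choice of bdlin by <:].

Lemma bounded_linear_submod : submod_closed bounded_linear.
Proof.
split=> [|a f g /asboolP[lf [M fM]] /asboolP[lg [N gN]]].
  apply/asboolP; split; first by move=> a x y; rewrite -[LHS]/(0 : W)
    -[RHS]/(a *: (0 : W) + 0) scaler0 addr0.
  by exists 0 => x; rewrite -[X in `|X|]/(0 : W) normr0 mul0r.
have E x : (a *: f + g) x = a *: f x + g x by [].
apply/asboolP; split.
  by move=> b x y; rewrite !E lf lg !scalerDr !scalerA (mulrC a b) addrACA.
exists (`|a| * M + N) => x; rewrite E (le_trans (ler_normD _ _))//.
by rewrite mulrDl lerD// normrZ -mulrA ler_wpM2l.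
Qed.

HB.instance Definition _ :=
  GRing.isSubmodClosed.Build R[i] (V -> W) bounded_linear bounded_linear_submod.
HB.instance Definition _ := [SubChoice_isSubLmodule of bdlin by <:].

Definition opnorm (A : bdlin) : \bar R :=
  ereal_sup [set (nrm (A x))%:E | x in [set x : V | nrm x <= 1]].

End BoundedLinear.

(* [{dot E for conjC}] is linear in its first variable. *)
Record innerProduct (R : realType) (E : normedModType R[i]) := InnerProduct {
  ip :> {dot E for @Num.conj R[i]} ;
  ip_norm : forall x, ip x x = `|x| ^+ 2 }.

Record hilbertSpace (R : realType) := HilbertSpace {
  hilb_sort :> completeNormedModType R[i] ;
  hilb_ip : innerProduct hilb_sort }.

Section ell2.
Variables (R : realType) (I : Type).

Definition ell2_norm (f : I -> R[i]) : \bar R :=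
  ((\esum_(i in [set: {classic I}]) (nrm (f i) ^+ 2)%:E) `^ 2^-1)%E.

Definition ell2 : set (I -> R[i]) := [set f | (ell2_norm f < +oo)%E].

Definition isometric_to_ell2 (E : normedModType R[i]) : Prop :=
  exists T : {linear E -> (I -> R[i]^o)},
    (forall x, ell2_norm (T x) = (nrm x)%:E) /\ range T = ell2.

End ell2.

Section OperatorMatrices.
Variables (R : realType).

(* the norm of the Hilbertian direct sum of n copies of (V, N) *)
Definition dsum_norm (V : Type) (N : V -> R) n (h : 'I_n -> V) : R :=
  Num.sqrt (\sum_i N (h i) ^+ 2).

Definition opmx_norm (V : zmodType) (N : V -> R) n (A : 'M[V -> V]_n) : \bar R :=
  ereal_sup [set (dsum_norm N (fun i => \sum_j A i j (h j)))%:E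
            | h in [set h : 'I_n -> V | dsum_norm N h <= 1]].

End OperatorMatrices.

Record operatorSpace (R : realType) (H : hilbertSpace R) := OperatorSpace {
  os_sort :> completeNormedModType R[i] ;
  os_emb : {linear os_sort -> bdlin H H} ;
  os_emb_isom : forall x, opnorm (os_emb x) = (nrm x)%:E }.

(* A complex vector space with, for each n, a norm on the n x n matrices over it.
   The matrix norms are extended-real valued so that suprema need no side
   condition. *)
Record mxNormedSpace (R : realType) := MxNormedSpace {
  mxn_sort :> lmodType R[i] ;
  mxn_norm : forall n, 'M[mxn_sort]_n -> \bar R }.

Section MatrixNorms.
Variables (R : realType).

Definition os_mxNormed (H : hilbertSpace R) (E : operatorSpace H) :
    mxNormedSpace R :=
  @MxNormedSpace R E (fun n x =>
    opmx_norm (@nrm R H) (map_mx (fun e : E => os_emb E e : H -> H) x)).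

(* M_k = B(C^k), with C^k = 'cV_k carrying the Euclidean norm *)
Definition matrix_mxNormed (k : nat) : mxNormedSpace R :=
  @MxNormedSpace R 'M[R[i]]_k (fun n (x : 'M['M[R[i]]_k]_n) =>
    opmx_norm (fun v : 'cV[R[i]]_k => dsum_norm (@nrm R R[i]) (fun i => v i 0))
      (map_mx (fun (a : 'M[R[i]]_k) (v : 'cV[R[i]]_k) => a *m v) x)).

Definition cb_norm (E F : mxNormedSpace R) (u : E -> F) : \bar R :=
  ereal_sup [set ereal_sup [set mxn_norm (map_mx u x)
                           | x in [set x : 'M[E]_n | (mxn_norm x <= 1)%E]]
            | n in [set: nat]].

(* The n x n matrices over the dual E* are normed as cb(E, M_n): the matrix (f_ij)
   is the map e |-> (f_ij(e)). *)
Definition dual_mxNormed (H : hilbertSpace R) (E : operatorSpace H) :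
    mxNormedSpace R :=
  @MxNormedSpace R (bdlin E R[i]^o) (fun n (f : 'M[bdlin E R[i]^o]_n) =>
    @cb_norm (os_mxNormed E) (matrix_mxNormed n)
      (fun e : E => \matrix_(i, j) f i j e)).

Definition complete_isometry (E F : mxNormedSpace R) (u : {linear E -> F}) :=
  forall n (x : 'M[E]_n), mxn_norm (map_mx u x) = mxn_norm x.

Definition completely_isometric (E F : mxNormedSpace R) : Prop :=
  exists u : {linear E -> F}, set_surj [set: E] [set: F] u /\ complete_isometry u.

End MatrixNorms.

Definition conj_module (V : Type) : Type := V.

Section ConjModule.
Variables (R : realType) (V : lmodType R[i]).

HB.instance Definition _ := GRing.Zmodule.on (conj_module V).

Definition conj_scale (a : R[i]) (x : conj_module V) : conj_module V :=
  (Num.conj a *: (x : V) : V).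

Lemma conj_scaleA a b x : conj_scale a (conj_scale b x) = conj_scale (a * b) x.
Proof. by rewrite /conj_scale scalerA rmorphM. Qed.
Lemma conj_scale1 : left_id 1 conj_scale.
Proof. by move=> x; rewrite /conj_scale rmorph1 scale1r. Qed.
Lemma conj_scaleDr : right_distributive conj_scale +%R.
Proof. by move=> a x y; rewrite /conj_scale scalerDr. Qed.
Lemma conj_scaleDl x : {morph conj_scale^~ x : a b / a + b}.
Proof. by move=> a b; rewrite /conj_scale rmorphD scalerDl. Qed.

HB.instance Definition _ := GRing.Zmodule_isLmodule.Build R[i] (conj_module V)
  conj_scaleA conj_scale1 conj_scaleDr conj_scaleDl.

End ConjModule.

Section ConjNormed.
Variables (R : realType) (V : normedModType R[i]).

HB.instance Definition _ := PseudoMetricNormedZmod.copy (conj_module V) V.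

Lemma conj_normrZ (a : R[i]) (x : conj_module V) : `|a *: x| = `|a| * `|x|.
Proof. by rewrite -[a *: x]/(Num.conj a *: (x : V)) normrZ norm_conjC. Qed.

HB.instance Definition _ :=
  PseudoMetricNormedZmod_Lmodule_isNormedModule.Build R[i] (conj_module V)
    conj_normrZ.
End ConjNormed.

HB.instance Definition _ (R : realType) (V : completeNormedModType R[i]) :=
  Complete.copy (conj_module V) V.

(* [conj_mxNormed] leaves the matrix norms unchanged because an operator on H is
   the same map on the conjugate Hilbert space. [conj_mxNormedE] below checks
   that, for E in B(H), it is the structure induced by B(conj H). *)
Definition conj_mxNormed (R : realType) (E : mxNormedSpace R) : mxNormedSpace R :=
  @MxNormedSpace R (conj_module E) (fun n (x : 'M[E]_n) => mxn_norm x).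

Section ConjIp.
Variables (R : realType) (V : normedModType R[i]) (f : innerProduct V).

Definition conj_ip (x y : conj_module V) : R[i] := f (y : V) (x : V).

Lemma conj_ip_bilinear : bilinear_for (GRing.Scale.Law.clone _ _ *%R _)
  (GRing.Scale.Law.clone _ _ (Num.conj \; *%R) _) conj_ip.
Proof.
split=> y a x z.
  by rewrite -[LHS]/(f y (Num.conj a *: (x : V) + (z : V))) linearPr /= conjCK.
by rewrite -[LHS]/(f (Num.conj a *: (x : V) + (z : V)) y) linearPl.
Qed.

HB.instance Definition _ := @bilinear_isBilinear.Build R[i] (conj_module V)
  (conj_module V) R[i] *%R (Num.conj \; *%R) conj_ip conj_ip_bilinear.

Lemma conj_ip_herm x y : conj_ip x y = (-1) ^+ false * Num.conj (conj_ip y x).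
Proof. exact: (hermC f). Qed.

HB.instance Definition _ := @isHermitianSesquilinear.Build R[i] (conj_module V)
  false Num.conj conj_ip conj_ip_herm.

Lemma conj_ip_gt0 x : x != 0 -> 0 < conj_ip x x.
Proof. exact: (@neq0_dnorm_gt0 _ _ _ f). Qed.

HB.instance Definition _ :=
  @isDotProduct.Build R[i] (conj_module V) conj_ip conj_ip_gt0.

Lemma conj_ip_norm x : conj_ip x x = `|x| ^+ 2.
Proof. exact: (ip_norm f). Qed.

Definition conj_innerProduct : innerProduct (conj_module V) :=
  @InnerProduct R (conj_module V) conj_ip conj_ip_norm.
End ConjIp.

Definition conj_hilbertSpace (R : realType) (H : hilbertSpace R) :=
  @HilbertSpace R (conj_module H) (conj_innerProduct (hilb_ip H)).

Section ConjOp.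
Variables (R : realType) (H : hilbertSpace R) (E : operatorSpace H).

Lemma conj_bounded (A : bdlin H H) :
  (A : conj_module H -> conj_module H) \in
    @bounded_linear R (conj_module H) (conj_module H).
Proof.
have /asboolP[lA [M AM]] := bdfunP A.
apply/asboolP; split; last by exists M => x; apply: AM.
by move=> a x y; apply: lA.
Qed.

Definition conj_emb (x : conj_module E) :
    bdlin (conj_hilbertSpace H) (conj_hilbertSpace H) :=
  @BdLin _ (conj_module H) (conj_module H) _ (conj_bounded (os_emb E x)).

Lemma conj_emb_linear : linear conj_emb.
Proof.
move=> a x y; apply: val_inj; apply/funext => z.
rewrite -[LHS]/(os_emb E (Num.conj a *: (x : E) + (y : E)) z).
by rewrite linearP.
Qed.

HB.instance Definition _ := GRing.isLinear.Build R[i] (conj_module E)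
  (bdlin (conj_hilbertSpace H) (conj_hilbertSpace H)) *:%R conj_emb conj_emb_linear.

Lemma conj_emb_isom x : opnorm (conj_emb x) = (nrm x)%:E.
Proof. exact: (os_emb_isom (x : E)). Qed.

Definition conj_operatorSpace : operatorSpace (conj_hilbertSpace H) :=
  @OperatorSpace R (conj_hilbertSpace H) (conj_module E) conj_emb conj_emb_isom.

Lemma conj_mxNormedE :
  conj_mxNormed (os_mxNormed E) = os_mxNormed conj_operatorSpace.
Proof. by []. Qed.
End ConjOp.

Definition antidual_mxNormed (R : realType) (H : hilbertSpace R)
    (E : operatorSpace H) : mxNormedSpace R :=
  conj_mxNormed (dual_mxNormed E).

(* [CauchySchwarz] in the library is restricted to finite dimension. *)
Lemma dot_cauchy_schwarz (C : numClosedFieldType) (U : lmodType C)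
    (f : {dot U for @Num.conj C}) (u v : U) :
  `|f u v| ^+ 2 <= f u u * f v v.
Proof.
have [->|v0] := eqVneq v 0.
  by rewrite linear0r normr0 expr0n mulr_ge0 ?dnorm_ge0.
have vv0 : 0 < f v v by rewrite dnorm_gt0.
have vvr : (f v v)^* = f v v by apply/CrealP/ger0_real/ltW.
have := dnorm_ge0 f (u - (f u v / f v v) *: v).
rewrite dnormB dnormZ linearZr_LR /=.
set d := f v v in vv0 vvr *; set a := `|f u v| ^+ 2.
have -> : (f u v / d)^* * f u v = a / d.
  by rewrite rmorphM fmorphV /= vvr mulrAC -normCKC.
have -> : (a / d)^* = a / d.
  by apply/CrealP/ger0_real; rewrite divr_ge0 ?exprn_ge0 ?normr_ge0 ?(ltW vv0).
rewrite normf_div (gtr0_norm vv0) expr_div_n -/a.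
rewrite [d ^+ 2]expr2 invfM -!mulrA mulVf ?gt_eqF// mulr1.
rewrite opprD addrACA subrr addr0 subr_ge0.
by rewrite mulrA -expr2 ler_pdivrMr.
Qed.

Section NaturalIdentification.
Variables (R : realType) (H : hilbertSpace R) (E : operatorSpace H).
Variable (ip : innerProduct E).

Lemma ip_cauchy_schwarz (u v : E) : `|ip u v| <= `|u| * `|v|.
Proof.
rewrite -(@ler_pXn2r _ 2) ?nnegrE ?mulr_ge0// exprMn -!(ip_norm ip).
exact: dot_cauchy_schwarz.
Qed.

Lemma ip_bounded_linear (x : E) :
  (fun y : E => ip y x : R[i]^o) \in @bounded_linear R E R[i]^o.
Proof.
apply/asboolP; split; first by move=> a y z; rewrite linearPl.
by exists `|x| => y; rewrite mulrC; exact: ip_cauchy_schwarz.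
Qed.

Definition natural_id (x : os_mxNormed E) : antidual_mxNormed E :=
  BdLin (ip_bounded_linear x).

Lemma natural_id_linear : linear natural_id.
Proof.
move=> a x y; apply: val_inj; apply/funext => z /=.
by rewrite linearPr.
Qed.

HB.instance Definition _ :=
  GRing.isLinear.Build R[i] (os_mxNormed E) (antidual_mxNormed E) *:%R
    natural_id natural_id_linear.

End NaturalIdentification.

(* By polarization the norm of E determines [ip], so that the existential involves
   no choice. *)
Definition self_antidual (R : realType) (H : hilbertSpace R)
    (E : operatorSpace H) : Prop :=
  exists ip : innerProduct E,
    complete_isometry
      (natural_id ip : {linear os_mxNormed E -> antidual_mxNormed E}).

(* Main.v *)
(** For matrices x, y over a Hilbert space E let G(x, y) be the operator norm of
    the scalar matrix (<x i j, y p q>), with rows (i, p) and columns (j, q).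
    Haagerup's Cauchy-Schwarz inequality says G(x, y)^2 <= G(x, x) G(y, y).  The
    norm of x in the antidual of E is the supremum of G(x, y) over the unit balls
    of all the spaces of matrices over E.  If it agrees with the norm ||x|| of E,
    testing at y = x / ||x|| gives G(x, x) <= ||x||^2, and the inequality gives
    the converse.  So self-antiduality means ||x||^2 = G(x, x) at every matrix
    size, which determines the operator space structure from the inner product:
    this is uniqueness.  For existence, let E act by the direct sum, over all y
    with G(y, y) <= 1, of the maps x |-> (<x, y p q>)_{p, q}.  The matrix norms so
    obtained are the suprema of G(x, y) over G(y, y) <= 1, that is
    G(x, x)^(1/2). *)
Require Import Defs.
From HB Require Import structures.
From mathcomp Require Import all_boot all_order all_algebra.
From mathcomp Require Import sesquilinear spectral complex finmap.
From mathcomp Require Import all_classical all_reals all_analysis.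
From mathcomp Require Import ring lra.

Set Implicit Arguments.
Unset Strict Implicit.
Unset Printing Implicit Defensive.

Import Order.TTheory GRing.Theory Num.Theory.
Import numFieldNormedType.Exports.

Local Open Scope classical_set_scope.
Local Open Scope complex_scope.
Local Open Scope ring_scope.
Local Open Scope sesquilinear_scope.

(** * Haagerup's Cauchy-Schwarz inequality *)

Section FiniteCauchySchwarz.
Variable C : numClosedFieldType.
Implicit Types (m n p : nat).

(** After passing to absolute values, twice the difference of the two sides is the sum over [k] and
    [l] of the squares of |a k| |b l| - |a l| |b k|. *)
Lemma cauchy_schwarz_sum (K : finType) (a b : K -> C) :
  `|\sum_k a k * b k| ^+ 2 <= (\sum_k `|a k| ^+ 2) * (\sum_k `|b k| ^+ 2).
Proof.
apply: (@le_trans _ _ ((\sum_k `|a k| * `|b k|) ^+ 2)).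
  rewrite ler_pXn2r ?nnegrE ?sumr_ge0 ?normr_ge0 ?mulr_ge0//.
  by rewrite (le_trans (ler_norm_sum _ _ _))// ler_sum// => k _; rewrite normrM.
rewrite -(ler_pM2l (ltr0Sn C 1)) expr2 !big_distrlr /= !mulr_natl [leRHS]mulr2n.
rewrite [X in _ + X]exchange_big -big_split -sumrMnl /=.
apply: ler_sum => k _; rewrite -big_split -sumrMnl; apply: ler_sum => l _ /=.
have := @real_exprn_even_ge0 C 2 (`|a k| * `|b l| - `|a l| * `|b k|).
rewrite realB ?realM ?normr_real// => /(_ isT isT).
rewrite sqrrB addrAC subr_ge0 !exprMn => h; apply: le_trans h.
by rewrite mulrACA [in leRHS]mulrACA (mulrC `|b l|).
Qed.

(** Cauchy-Schwarz in a direct sum of copies of [U], without forming that sum: the form is estimated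
    termwise, then the scalar inequality is used on the norms [r x k] and [r y k]. *)
Lemma dot_cauchy_schwarz_sum (U : lmodType C) (f : {dot U for @Num.conj C})
    (K : finType) (x y : K -> U) :
  `|\sum_k f (x k) (y k)| ^+ 2 <=
  (\sum_k f (x k) (x k)) * (\sum_k f (y k) (y k)).
Proof.
pose r (z : K -> U) k := sqrtC (f (z k) (z k)).
have r0 z k : 0 <= r z k by rewrite sqrtC_ge0 dnorm_ge0.
have rE z k : `|r z k| ^+ 2 = f (z k) (z k) by rewrite ger0_norm// sqrtCK.
apply: (@le_trans _ _ ((\sum_k r x k * r y k) ^+ 2)).
  rewrite ler_pXn2r ?nnegrE ?sumr_ge0 ?normr_ge0 ?mulr_ge0//.
    rewrite (le_trans (ler_norm_sum _ _ _))// ler_sum// => k _.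
    rewrite -(@ler_pXn2r _ 2) ?nnegrE ?mulr_ge0//.
    by rewrite exprMn !sqrtCK dot_cauchy_schwarz.
  by move=> k _; rewrite mulr_ge0.
have S0 : 0 <= \sum_k r x k * r y k by rewrite sumr_ge0// => k _; rewrite mulr_ge0.
rewrite -(ger0_norm S0).
rewrite (le_trans (cauchy_schwarz_sum _ _))//.
by under eq_bigr do rewrite rE; under [X in _ * X]eq_bigr do rewrite rE.
Qed.

(** Squared Hilbert-Schmidt norm. *)
Definition fro2 m n (A : 'M[C]_(m, n)) : C := \sum_i \sum_j `|A i j| ^+ 2.

Lemma fro2_ge0 m n (A : 'M[C]_(m, n)) : 0 <= fro2 A.
Proof. by rewrite sumr_ge0// => i _; rewrite sumr_ge0// => j _; rewrite exprn_ge0. Qed.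

Lemma fro2_pair m n (A : 'M[C]_(m, n)) : fro2 A = \sum_k `|A k.1 k.2| ^+ 2.
Proof. by rewrite /fro2 pair_bigA. Qed.

Lemma fro2_conj m n (A : 'M[C]_(m, n)) : fro2 (map_mx Num.conj A) = fro2 A.
Proof. by apply: eq_bigr => i _; apply: eq_bigr => j _; rewrite mxE norm_conjC. Qed.

Lemma fro2_adj n m (A : 'M[C]_(n, m)) : fro2 (A^t*) = fro2 A.
Proof.
rewrite /fro2 exchange_big /=; apply: eq_bigr => i _; apply: eq_bigr => j _.
by rewrite !mxE norm_conjC.
Qed.

Lemma fro2_trace m n (A : 'M[C]_(m, n)) : fro2 A = \tr (A *m A^t*).
Proof.
by apply: eq_bigr => i _; rewrite mxE; apply: eq_bigr => j _; rewrite !mxE normCK.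
Qed.

(** Both sides are traces of a fourfold product of [A] and its adjoint in alternation, equal by
    cyclicity. *)
Lemma fro2_mul_adj m n (A : 'M[C]_(m, n)) : fro2 (A *m A^t*) = fro2 (A^t* *m A).
Proof.
rewrite !fro2_trace !trmx_mul !map_mxM /= trmxCK -!mulmxA.
by rewrite mxtrace_mulC !mulmxA.
Qed.

(* With [A] the polar product [U * |A|], the factors are [U * |A|^(1/2)] and
   [|A|^(1/2)]. *)
Lemma fro2_factor n m (A : 'M[C]_(n, m)) :
  exists (B : 'M[C]_(n, m)) (D : 'M[C]_m),
    [/\ A = B *m D, fro2 (B *m B^t*) <= fro2 A & fro2 (D^t* *m D) <= fro2 A].
Proof.
pose S := A^t* *m A.
have nS : S \is normalmx.
  by apply/normalmxP; rewrite /S trmx_mul map_mxM /= trmxCK.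
pose P := spectralmx S; pose d := spectral_diag S.
have uP : P \is unitarymx := spectral_unitarymx S.
have uP1 : P *m P^t* = 1%:M by apply/unitarymxP.
have uP2 : P^t* *m P = 1%:M by exact: mulmx1C.
have SE : S = P^t* *m diag_mx d *m P.
  by rewrite -(invmx_unitary uP); exact/orthomx_spectralP.
(* [U] is [A] written in an eigenbasis of [S], not the polar isometry: its columns are orthogonal
   and their squared norms are the eigenvalues [d]. *)
pose U := A *m P^t*.
have UU : U^t* *m U = diag_mx d.
  rewrite /U trmx_mul map_mxM /= trmxCK !mulmxA -(mulmxA P) -/S SE.
  by rewrite !mulmxA uP1 mul1mx -mulmxA uP1 mulmx1.
have UP : U *m P = A by rewrite -mulmxA uP2 mulmx1.
clearbody U.
have dE i : d 0 i = \sum_k `|U k i| ^+ 2.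
  have /matrixP/(_ i i) := UU; rewrite !mxE eqxx mulr1n => <-.
  by apply: eq_bigr => k _; rewrite !mxE normCKC.
have d0 i : 0 <= d 0 i by rewrite dE sumr_ge0// => k _; rewrite exprn_ge0.
(* A zero eigenvalue kills its column, so the convention [0^-1 = 0] in [B0] loses nothing. *)
have dU i k : d 0 i = 0 -> U k i = 0.
  rewrite dE => /eqP; rewrite psumr_eq0; last by move=> j _; rewrite exprn_ge0.
  move=> /allP/(_ k); rewrite mem_index_enum => /(_ isT) /=.
  by rewrite sqrf_eq0 normr_eq0 => /eqP.
(* The eigenvalues of |A|^2 are [d], so those of |A|^(1/2) are the fourth roots. *)
pose r i := sqrtC (sqrtC (d 0 i)).
have r0 i : 0 <= r i by rewrite !sqrtC_ge0.
have rE i : r i ^+ 2 ^+ 2 = d 0 i by rewrite !sqrtCK.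
have rd i : r i = 0 -> d 0 i = 0 by rewrite -rE => ->; rewrite !expr0n.
have rC i : Num.conj (r i) = r i by apply/CrealP/ger0_real.
have rVC i : Num.conj (r i)^-1 = (r i)^-1 by rewrite fmorphV /= rC.
have fA : fro2 A = \sum_i d 0 i.
  rewrite fro2_trace mxtrace_mulC -/S SE mxtrace_mulC mulmxA uP1 mul1mx.
  exact: mxtrace_diag.
pose D0 := diag_mx (\row_i r i); pose B0 := U *m diag_mx (\row_i (r i)^-1).
have D0C : D0^t* = D0.
  apply/matrixP => i j; rewrite !mxE eq_sym; case: eqP => [->|_].
    by rewrite !mulr1n rC.
  by rewrite !mulr0n conjC0.
exists B0, (D0 *m P); split.
- rewrite mulmxA (_ : B0 *m D0 = U); first by rewrite UP.
  rewrite /B0 -mulmxA mulmx_diag; apply/matrixP => k i; rewrite mul_mx_diag !mxE.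
  have [/rd/dU->|ri] := eqVneq (r i) 0; first by rewrite mul0r.
  by rewrite mulVf// mulr1.
(* In the other order, the product of [B0] and its adjoint is diagonal with entries r^-1 d r^-1 =
   r^2, whose squares sum to [fro2 A]. *)
- rewrite fro2_mul_adj /B0 trmx_mul map_mxM /= mulmxA -(mulmxA _ (U^t*)) UU.
  rewrite (_ : (diag_mx _)^t* = diag_mx (\row_i (r i)^-1)); last first.
    apply/matrixP => i j; rewrite !mxE eq_sym; case: eqP => [->|_].
      by rewrite !mulr1n rVC.
    by rewrite !mulr0n conjC0.
  rewrite !mulmx_diag fA /fro2 ler_sum// => i _.
  rewrite (bigD1 i)//= big1 ?addr0 => [|j ji]; last first.
    by rewrite !mxE eq_sym (negPf ji) mulr0n normr0 expr0n.
  rewrite !mxE eqxx mulr1n.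
  have [/rd->|ri] := eqVneq (r i) 0; first by rewrite mulr0 mul0r normr0 expr0n.
  rewrite (_ : (r i)^-1 * d 0 i / r i = r i ^+ 2).
    by rewrite ger0_norm ?exprn_ge0// rE.
  by rewrite -rE !expr2 !mulrA mulVf// mul1r mulfK.
- rewrite -fro2_mul_adj trmx_mul map_mxM /= mulmxA -(mulmxA D0) uP1 mulmx1 D0C.
  rewrite mulmx_diag fA /fro2 ler_sum// => i _.
  rewrite (bigD1 i)//= big1 ?addr0 => [|j ji]; last first.
    by rewrite !mxE eq_sym (negPf ji) mulr0n normr0 expr0n.
  by rewrite !mxE eqxx mulr1n ger0_norm ?mulr_ge0// -expr2 rE.
Qed.

End FiniteCauchySchwarz.

(** * Operator bounds for Gram matrices *)

Section GramForm.
Variables (C : numClosedFieldType) (U : lmodType C).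
Variable f : {dot U for @Num.conj C}.
Implicit Types (m n p : nat).

(** The scalar matrix with entries [f (x i j) (y p q)], rows [(i, p)] and columns [(j, q)], applied
    to [A] seen as a vector indexed by the pairs [(j, q)]. The Euclidean norm of such a vector is
    the Hilbert-Schmidt norm. *)
Definition gram_mx n m (x : 'M[U]_n) (y : 'M[U]_m) (A : 'M[C]_(n, m)) :
    'M[C]_(n, m) :=
  \matrix_(i, p) \sum_j \sum_q f (x i j) (y p q) * A j q.

Lemma dot_sum_comb n m r (A : 'M[C]_(n, r)) (B : 'M[C]_(m, r))
    (u : 'I_n -> U) (v : 'I_m -> U) :
  \sum_s f (\sum_i A i s *: u i) (\sum_p B p s *: v p) =
  \sum_i \sum_p (A *m B^t*) i p * f (u i) (v p).
Proof.
have E s : f (\sum_i A i s *: u i) (\sum_p B p s *: v p) =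
    \sum_i \sum_p A i s * Num.conj (B p s) * f (u i) (v p).
  rewrite linear_sumlz; apply: eq_bigr => i _; rewrite linear_sumr.
  by apply: eq_bigr => p _; rewrite linearZl_LR linearZr_LR /= mulrA.
under eq_bigr do rewrite E; rewrite exchange_big; apply: eq_bigr => i _ /=.
rewrite exchange_big; apply: eq_bigr => p _ /=; rewrite mxE mulr_suml.
by apply: eq_bigr => s _; rewrite !mxE.
Qed.

(** The entries of the product of [A^T], [x] and [B], indexed by pairs. *)
Definition mx_comb n r s (A : 'M[C]_(n, r)) (B : 'M[C]_(n, s)) (x : 'M[U]_n)
    (k : 'I_r * 'I_s) : U :=
  \sum_i A i k.1 *: \sum_j B j k.2 *: x i j.

(** [dot_sum_comb] is used on the row indices and then on the column indices. It turns a pairing of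
    a scalar matrix with a Gram image, once both arguments are factored, into one sum of inner
    products. *)
Lemma dot_mx_comb n m r s (A : 'M[C]_(n, r)) (B : 'M[C]_(n, s))
    (A' : 'M[C]_(m, r)) (B' : 'M[C]_(m, s)) (x : 'M[U]_n) (y : 'M[U]_m) :
  \sum_k f (mx_comb A B x k) (mx_comb A' B' y k) =
  \sum_k (A *m A'^t*) k.1 k.2 * gram_mx x y (B *m B'^t*) k.1 k.2.
Proof.
rewrite -(pair_bigA _ (fun a b => f (mx_comb A B x (a, b)) (mx_comb A' B' y (a, b)))).
rewrite -(pair_bigA _ (fun a b => (A *m A'^t*) a b * gram_mx x y (B *m B'^t*) a b)).
rewrite /mx_comb /= exchange_big; under eq_bigr do rewrite dot_sum_comb.
rewrite exchange_big; apply: eq_bigr => i _ /=.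
rewrite exchange_big; apply: eq_bigr => p _ /=.
rewrite -mulr_sumr dot_sum_comb; congr (_ * _); rewrite mxE.
by apply: eq_bigr => j _; apply: eq_bigr => q _; rewrite mulrC.
Qed.

(** For [0 <= c] this says that the Gram matrix has operator norm at most [c]; the constant is
    squared because [fro2] is. *)
Definition gram_bounded n m (x : 'M[U]_n) (y : 'M[U]_m) (c : C) : Prop :=
  forall A, fro2 (gram_mx x y A) <= c ^+ 2 * fro2 A.

(** Cauchy-Schwarz for the pairing in [dot_mx_comb] separates the two products, and the Gram bound
    is applied to the one built from [B]. *)
Lemma dot_mx_comb_le n r s (A : 'M[C]_(n, r)) (B : 'M[C]_(n, s)) x (c a b : C) :
  0 <= c -> gram_bounded x x c ->
  fro2 (A *m A^t*) <= a -> fro2 (B *m B^t*) <= b ->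
  (\sum_k f (mx_comb A B x k) (mx_comb A B x k)) ^+ 2 <= c ^+ 2 * (a * b).
Proof.
move=> c0 xc Aa Bb.
have S0 : 0 <= \sum_k f (mx_comb A B x k) (mx_comb A B x k).
  by rewrite sumr_ge0// => k _; exact: dnorm_ge0.
rewrite -(ger0_norm S0).
rewrite dot_mx_comb (le_trans (cauchy_schwarz_sum _ _))// -!fro2_pair mulrCA.
rewrite ler_pM ?fro2_ge0// (le_trans (xc _))// ler_wpM2l// exprn_ge0//.
Qed.

(* Haagerup's Cauchy-Schwarz inequality. The pairing of [gram_mx x y A] with a
   matrix [Z] is a single inner product of a combination of the [x i j] with one
   of the [y p q], once [A] and [Z] are written as products. *)
Lemma gram_bounded_mul n m (x : 'M[U]_n) (y : 'M[U]_m) (a b : C) :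
  0 <= a -> 0 <= b -> gram_bounded x x (a ^+ 2) -> gram_bounded y y (b ^+ 2) ->
  gram_bounded x y (a * b).
Proof.
move=> a0 b0 xa yb A; set Z := gram_mx x y A.
have [B [D [AE Bb Dd]]] := fro2_factor A.
have [G [F [ZE Gg Ff]]] := fro2_factor Z.
(* The coefficients are chosen so that [dot_mx_comb] pairs the conjugate of [Z = G *m F] with
   [gram_mx x y (B *m D) = Z]; the value is [fro2 Z]. *)
pose X := mx_comb (map_mx Num.conj G) B x; pose Y := mx_comb F^T (D^t*) y.
have ZXY : fro2 Z = `|\sum_k f (X k) (Y k)|.
  rewrite dot_mx_comb trmxK trmxCK -AE -map_mxM -ZE -/Z fro2_pair.
  move: (Z) => W.
  rewrite ger0_norm.
    by apply: eq_bigr => k _; rewrite mxE normCKC.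
  by rewrite sumr_ge0// => k _; rewrite mxE -normCKC exprn_ge0.
have XX : (\sum_k f (X k) (X k)) ^+ 2 <= a ^+ 2 ^+ 2 * (fro2 Z * fro2 A).
  apply: dot_mx_comb_le => //; first by rewrite exprn_ge0.
  by rewrite map_trmx -map_mxM fro2_conj.
have YY : (\sum_k f (Y k) (Y k)) ^+ 2 <= b ^+ 2 ^+ 2 * (fro2 Z * fro2 A).
  apply: dot_mx_comb_le => //; first by rewrite exprn_ge0.
    rewrite trmxK -fro2_conj map_mxM -map_mx_comp (map_mx_id (@conjCK _)).
    exact: Ff.
  by rewrite trmxCK.
have X0 : 0 <= \sum_k f (X k) (X k) by rewrite sumr_ge0// => k _; exact: dnorm_ge0.
have Y0 : 0 <= \sum_k f (Y k) (Y k) by rewrite sumr_ge0// => k _; exact: dnorm_ge0.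
have Z2 : fro2 Z ^+ 2 <= (a * b) ^+ 2 * (fro2 Z * fro2 A).
  have S0 : 0 <= (a * b) ^+ 2 * (fro2 Z * fro2 A).
    by rewrite mulr_ge0 ?exprn_ge0// mulr_ge0 ?fro2_ge0.
  (* [XX] and [YY] bound squares, so the Cauchy-Schwarz bound [ZP] is squared once more before they
     are inserted. *)
  rewrite -(@ler_pXn2r _ 2) ?nnegrE ?exprn_ge0 ?fro2_ge0//.
  have ZP : fro2 Z ^+ 2 <= (\sum_k f (X k) (X k)) * (\sum_k f (Y k) (Y k)).
    by rewrite {1}ZXY dot_cauchy_schwarz_sum.
  apply: (@le_trans _ _ (((\sum_k f (X k) (X k)) * (\sum_k f (Y k) (Y k))) ^+ 2)).
    by rewrite ler_pXn2r ?nnegrE ?exprn_ge0 ?fro2_ge0// mulr_ge0.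
  rewrite exprMn; apply: (le_trans (ler_pM _ _ XX YY)); rewrite ?exprn_ge0//.
  by rewrite mulrACA -(expr2 (fro2 Z * fro2 A)) -3!exprMn.
(* Unless it is zero, one factor [fro2 Z] cancels from [Z2]. *)
have [Z0|Z0] := eqVneq (fro2 Z) 0.
  by rewrite Z0 mulr_ge0 ?fro2_ge0 ?exprn_ge0 ?mulr_ge0.
rewrite -(@ler_pM2l _ (fro2 Z)) ?lt_def ?Z0 ?fro2_ge0// -expr2.
by rewrite (le_trans Z2)// mulrCA.
Qed.

Lemma gram_mxC n m (x : 'M[U]_n) (y : 'M[U]_m) (A : 'M[C]_(n, m)) :
  gram_mx y x (A^t*) = (gram_mx x y A)^t*.
Proof.
apply/matrixP => p i; rewrite !mxE rmorph_sum exchange_big /=.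
apply: eq_bigr => j _; rewrite rmorph_sum; apply: eq_bigr => q _.
by rewrite !mxE rmorphM [in LHS]hermC /= expr0 mul1r.
Qed.

(** Exchanging [x] and [y] conjugates the entries of the Gram matrix, which preserves its operator
    norm. *)
Lemma gram_bounded_sym n m (x : 'M[U]_n) (y : 'M[U]_m) (c : C) :
  gram_bounded x y c -> gram_bounded y x c.
Proof.
move=> xy A; have := xy (A^t*).
have -> : gram_mx y x A = (gram_mx x y (A^t*))^t* by rewrite -gram_mxC trmxCK.
by rewrite !fro2_adj.
Qed.

End GramForm.

(** * Duality of Gram bounds and operator norms *)

Section RealValued.
Variable R : realType.
Local Notation C := R[i].

Lemma nrmE (V : normedZmodType C) (x : V) : (nrm x)%:C = `|x|.
Proof. by rewrite /nrm RRe_real// normr_real. Qed.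

Lemma nrm_ge0 (V : normedZmodType C) (x : V) : 0 <= nrm x.
Proof. rewrite -lecR nrmE; exact: normr_ge0. Qed.

Lemma nrmM (a b : C) : nrm (a * b) = nrm a * nrm b.
Proof. by apply: complexI; rewrite rmorphM /= !nrmE normrM. Qed.

Lemma nrm_real (a : R) : nrm a%:C = `|a|.
Proof. by rewrite /nrm normc_def /= expr0n addr0 sqrtr_sqr. Qed.

Lemma nrm_sqr (V : normedZmodType C) (x : V) : (nrm x ^+ 2)%:C = `|x| ^+ 2.
Proof. by rewrite rmorphXn /= nrmE. Qed.

(** [fro2] with values in [R], where infima and extended real sums are taken. *)
Definition fro2R m n (A : 'M[C]_(m, n)) : R := \sum_i \sum_j nrm (A i j) ^+ 2.

Lemma fro2E m n (A : 'M[C]_(m, n)) : fro2 A = (fro2R A)%:C.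
Proof.
rewrite /fro2R rmorph_sum; apply: eq_bigr => i _.
by rewrite rmorph_sum; apply: eq_bigr => j _; rewrite -nrm_sqr.
Qed.

Lemma fro2R_ge0 m n (A : 'M[C]_(m, n)) : 0 <= fro2R A.
Proof. rewrite -lecR -fro2E; exact: fro2_ge0. Qed.

Lemma fro2Z m n (a : C) (A : 'M[C]_(m, n)) : fro2 (a *: A) = `|a| ^+ 2 * fro2 A.
Proof.
rewrite /fro2 mulr_sumr; apply: eq_bigr => i _; rewrite mulr_sumr.
by apply: eq_bigr => j _; rewrite mxE normrM exprMn.
Qed.

(** * Gram bounds recovered by duality *)

Section GramDual.
Variables (U : lmodType C) (f : {dot U for @Num.conj C}).

Lemma gram_boundedE n m (x : 'M[U]_n) (y : 'M[U]_m) (c : R) :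
  gram_bounded f x y c%:C <->
  forall A, fro2R (gram_mx f x y A) <= c ^+ 2 * fro2R A.
Proof.
by split=> xy A; have := xy A; rewrite !fro2E -rmorphXn -rmorphM lecR.
Qed.

Lemma gram_mxZl n m (a : C) (x : 'M[U]_n) (y : 'M[U]_m) A :
  gram_mx f (map_mx ( *:%R a) x) y A = a *: gram_mx f x y A.
Proof.
apply/matrixP => i p; rewrite !mxE mulr_sumr; apply: eq_bigr => j _.
rewrite mulr_sumr; apply: eq_bigr => q _.
by rewrite mxE linearZl_LR mulrA.
Qed.

Lemma gram_boundedZl n m (a : R) (x : 'M[U]_n) (y : 'M[U]_m) (c : R) :
  gram_bounded f x y c%:C ->
  gram_bounded f (map_mx ( *:%R a%:C) x) y (a * c)%:C.
Proof.
move=> xy A; rewrite gram_mxZl fro2Z.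
have -> : `|a%:C| ^+ 2 = a%:C ^+ 2.
  by rewrite -nrm_sqr nrm_real real_normK ?num_real// rmorphXn.
rewrite rmorphM exprMn -(mulrA (_ ^+ 2)) ler_wpM2l//.
by rewrite -rmorphXn -(rmorph0 (real_complex R)) lecR sqr_ge0.
Qed.

Lemma gram_boundedZr n m (a : R) (x : 'M[U]_n) (y : 'M[U]_m) (c : R) :
  gram_bounded f x y c%:C ->
  gram_bounded f x (map_mx ( *:%R a%:C) y) (a * c)%:C.
Proof. by move=> xy; apply/gram_bounded_sym/gram_boundedZl/gram_bounded_sym. Qed.

(** The constant is the squared Hilbert-Schmidt norm of the Gram matrix. It is crude but finite,
    which makes the set of bounds in [gram_bounded_dual] nonempty. *)
Lemma gram_mx_le n m (x : 'M[U]_n) (y : 'M[U]_m) :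
  exists2 M : R, 0 <= M & forall A, fro2R (gram_mx f x y A) <= M * fro2R A.
Proof.
exists (\sum_i \sum_p \sum_k nrm (f (x i k.1) (y p k.2)) ^+ 2).
  do 3![apply: sumr_ge0 => ? _]; exact: exprn_ge0 (nrm_ge0 _).
move=> A; rewrite /fro2R mulr_suml ler_sum// => i _; rewrite mulr_suml ler_sum// => p _.
rewrite mxE pair_bigA /= -lecR nrm_sqr (le_trans (cauchy_schwarz_sum _ _))//.
rewrite rmorphM !rmorph_sum -fro2_pair /=.
rewrite -/(fro2R A) -[X in _ <= _ * X]rmorph_sum /=.
by rewrite -/(fro2R A) -fro2E; under eq_bigr do rewrite -nrm_sqr.
Qed.

(* The least [M] with [fro2R (gram_mx f x x A) <= M * fro2R A] is attained.  Testing
   the hypothesis at [y = M ^ (-1/4) x] gives the constant [M ^ (1/2) * c ^ 2], so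
   [M <= M ^ (1/2) * c ^ 2] by minimality, that is [M <= c ^ 4]. *)
Lemma gram_bounded_dual n (x : 'M[U]_n) (c : R) : 0 < c ->
  (forall m (y : 'M[U]_m), gram_bounded f y y 1 -> gram_bounded f y x c%:C) ->
  gram_bounded f x x (c ^+ 2)%:C.
Proof.
move=> c0 dual.
pose T := [set M : R | 0 <= M /\ forall A, fro2R (gram_mx f x x A) <= M * fro2R A].
have T0 : T !=set0 by have [M M0 HM] := gram_mx_le x x; exists M.
have Tlb : has_lbound T by exists 0 => M [].
pose M := inf T.
have M0 : 0 <= M by apply: lb_le_inf => // N [].
have TM : T M.
  (* The infimum is attained: when [fro2R A] is nonzero, the condition at [A] is a lower bound on
     the members of [T], hence on their infimum. *)
  split=> // A; have [A0|A0] := eqVneq (fro2R A) 0.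
    by have [N [_ /(_ A)]] := T0; rewrite A0 !mulr0.
  have Agt : 0 < fro2R A by rewrite lt_def A0 fro2R_ge0.
  by rewrite -ler_pdivrMr//; apply: lb_le_inf => // N [_ NA]; rewrite ler_pdivrMr.
have Mc : M <= c ^+ 2 ^+ 2.
  have [->|MN0] := eqVneq M 0; first by rewrite !exprn_ge0// ltW.
  have Mgt : 0 < M by rewrite lt_def MN0.
  pose K := Num.sqrt (Num.sqrt M).
  have K0 : 0 < K by rewrite !sqrtr_gt0.
  have K4 : K ^+ 2 ^+ 2 = M by rewrite !sqr_sqrtr// sqrtr_ge0.
  (* [gram_bounded] squares its constant, so the bound M = K^4 is expressed by [K ^+ 2]; scaling
     each argument by [K^-1] brings it down to 1. *)
  have xK : gram_bounded f x x (K ^+ 2)%:C.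
    by apply/gram_boundedE => A; rewrite K4; case: TM => _; exact.
  have y1 : gram_bounded f (map_mx ( *:%R (K^-1)%:C) x) (map_mx ( *:%R (K^-1)%:C) x) 1.
    have := gram_boundedZl K^-1 (gram_boundedZr K^-1 xK).
    by rewrite expr2 mulKf ?gt_eqF// mulVf ?gt_eqF.
  have /(gram_boundedZl K) := dual _ _ y1.
  rewrite -map_mx_comp (_ : map_mx _ x = x); last first.
    apply/matrixP => i j; rewrite mxE /= scalerA -rmorphM divff ?gt_eqF//.
    by rewrite rmorph1 scale1r.
  move=> /gram_boundedE xKc.
  have : M <= (K * c) ^+ 2 by apply: ge_inf => //; split=> //; exact: sqr_ge0.
  rewrite -{1}K4 [(K * c) ^+ 2]exprMn -[K ^+ 2 ^+ 2]/(K ^+ 2 * K ^+ 2) ler_pM2l ?exprn_gt0// => Kc.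
  by rewrite -K4 ler_pXn2r ?nnegrE ?sqr_ge0.
apply/gram_boundedE => A; apply: le_trans (TM.2 A) _.
by rewrite ler_wpM2r ?fro2R_ge0.
Qed.

End GramDual.

(** Norms are compared through their positive real bounds [c]: matrices can be rescaled by [c^-1],
    and the applications need not treat the values 0 and infinity apart. *)
Lemma eq_ereal_bounds (a b : \bar R) : (0 <= a)%E -> (0 <= b)%E ->
  (forall c : R, 0 < c -> (a <= c%:E <-> b <= c%:E)%E) -> a = b.
Proof.
suff H (u v : \bar R) : (0 <= v)%E ->
    (forall c : R, 0 < c -> (v <= c%:E -> u <= c%:E)%E) -> (u <= v)%E.
  move=> a0 b0 ab; apply/le_anti/andP; split.
    by apply: H => // c c0; exact: (ab c c0).2.
  by apply: H => // c c0; exact: (ab c c0).1.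
case: v => [r| |]; [|by move=> *; rewrite leey|by []].
rewrite lee_fin => r0 uv; apply/lee_addgt0Pr => e e0.
by rewrite -EFinD; apply: uv; rewrite ?ltr_wpDl// lee_fin lerDl ltW.
Qed.

(** * Operator norms of matrices of maps *)

Section OperatorNorm.
Variables (V : lmodType C) (N : V -> R).
Hypothesis N_ge0 : forall v, 0 <= N v.
Hypothesis N_hom : forall (a : R) v, 0 <= a -> N (a%:C *: v) = a * N v.

Lemma dsum_normZ n (a : R) (h : 'I_n -> V) : 0 <= a ->
  dsum_norm N (fun i => a%:C *: h i) = a * dsum_norm N h.
Proof.
move=> a0; rewrite /dsum_norm; under eq_bigr do rewrite N_hom// exprMn.
by rewrite -mulr_sumr sqrtrM ?exprn_ge0// sqrtr_sqr ger0_norm.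
Qed.

Lemma dsum_norm_ge0 n (h : 'I_n -> V) : 0 <= dsum_norm N h.
Proof. exact: sqrtr_ge0. Qed.

Lemma dsum_norm_le n m (c : R) (g : 'I_n -> V) (h : 'I_m -> V) : 0 <= c ->
  (dsum_norm N g <= c * dsum_norm N h) <->
  (\sum_i N (g i) ^+ 2 <= c ^+ 2 * \sum_i N (h i) ^+ 2).
Proof.
have S0 k (u : 'I_k -> V) : 0 <= \sum_i N (u i) ^+ 2.
  by rewrite sumr_ge0// => i _; rewrite exprn_ge0.
move=> c0; rewrite -(@ler_pXn2r _ 2 _ (dsum_norm N g))//; last first.
  by rewrite nnegrE mulr_ge0// dsum_norm_ge0.
  by rewrite nnegrE dsum_norm_ge0.
by rewrite exprMn !sqr_sqrtr.
Qed.

(** Homogeneity of [N] and of the entries of [A] turns the supremum over the unit ball into an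
    inequality for all vectors. *)
Lemma opmx_norm_le n (A : 'M[V -> V]_n) (c : R) :
  (forall i j (a : R) v, A i j (a%:C *: v) = a%:C *: A i j v) -> 0 <= c ->
  (opmx_norm N A <= c%:E)%E <->
  forall h, \sum_i N (\sum_j A i j (h j)) ^+ 2 <= c ^+ 2 * \sum_i N (h i) ^+ 2.
Proof.
move=> A_hom c0; split=> [Ac h|Ac]; last first.
  apply: ge_ereal_sup => _ [h /= h1 <-]; rewrite lee_fin.
  have /(dsum_norm_le _ _ c0) := Ac h; move/le_trans; apply.
  by rewrite -[leRHS]mulr1 ler_wpM2l.
apply/(dsum_norm_le (fun i => \sum_j A i j (h j)) h c0).
set D := dsum_norm N _; set s := dsum_norm N h.
have H t : 0 <= t -> t * s <= 1 -> t * D <= c.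
  move=> t0 ts; rewrite -lee_fin; apply: le_trans Ac.
  apply: ereal_sup_ubound; exists (fun j => t%:C *: h j) => /=.
    by rewrite dsum_normZ.
  congr (_%:E); rewrite -dsum_normZ//; congr dsum_norm; apply/funext => i.
  by rewrite scaler_sumr; apply: eq_bigr => j _; rewrite A_hom.
(* If [s = 0], every multiple of [h] lies in the unit ball; were [D] positive, the factor
   [(c + 1) / D] would give [c + 1 <= c]. *)
have [s0|sN0] := eqVneq s 0.
  rewrite s0 mulr0 leNgt; apply/negP => D0.
  have c1 : 0 <= c + 1 by rewrite addr_ge0.
  have := H ((c + 1) / D); rewrite s0 mulr0 ler01 divr_ge0 ?(ltW D0)//.
  by move=> /(_ isT isT); rewrite divfK ?gt_eqF// gerDl ler10.
have sgt : 0 < s by rewrite lt_def sN0 dsum_norm_ge0.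
have := H s^-1; rewrite invr_ge0 ltW// mulVf// lexx => /(_ isT isT).
by rewrite mulrC ler_pdivrMr.
Qed.

Lemma opmx_norm_ge0 n (A : 'M[V -> V]_n) : (0 <= opmx_norm N A)%E.
Proof.
apply: (@le_trans _ _ (dsum_norm N (fun i => \sum_j A i j 0))%:E).
  by rewrite lee_fin dsum_norm_ge0.
apply: ereal_sup_ubound; exists (fun=> 0) => //=.
rewrite /dsum_norm big1 ?sqrtr0 ?ler01// => i _.
by rewrite -(scale0r 0) -[X in X *: _]/(0%:C) N_hom// mul0r expr0n.
Qed.

End OperatorNorm.
End RealValued.

(** * Self-antidual operator spaces *)

Section SelfAntidual.
Variables (R : realType) (H : hilbertSpace R) (E : operatorSpace H).
Local Notation C := R[i].
Implicit Types (n m : nat).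

Lemma nrmZ (V : normedModType C) (a : C) (v : V) : nrm (a *: v) = nrm a * nrm v.
Proof. by apply: complexI; rewrite rmorphM /= !nrmE normrZ. Qed.

Lemma nrmZ_real (V : normedModType C) (a : R) (v : V) : 0 <= a ->
  nrm (a%:C *: v) = a * nrm v.
Proof. by move=> a0; rewrite nrmZ nrm_real ger0_norm. Qed.

Lemma bdlinZ (V W : normedModType C) (A : bdlin V W) (a : C) v :
  A (a *: v) = a *: A v.
Proof.
have /asboolP[lA _] := bdfunP A.
have A0 : A 0 = 0.
  have := lA 1 0 0; rewrite !scale1r addr0 => /esym.
  by move: (A 0) => z /(congr1 (+%R^~ (- z))); rewrite addrK subrr.
by have := lA a v 0; rewrite A0 !addr0.
Qed.

Lemma os_norm_le n (x : 'M[os_mxNormed E]_n) (c : R) : 0 <= c ->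
  (mxn_norm x <= c%:E)%E <->
  forall h : 'I_n -> H, \sum_i nrm (\sum_j os_emb E (x i j) (h j)) ^+ 2 <=
    c ^+ 2 * \sum_i nrm (h i) ^+ 2.
Proof.
move=> c0; have /= K := @opmx_norm_le R H (@nrm R H) (@nrm_ge0 R H)
  (@nrmZ_real H) n (map_mx (fun e : E => os_emb E e : H -> H) x) c _ c0.
apply: iff_trans (K _) _; first by move=> i j a v; rewrite !mxE bdlinZ.
split=> {}K h.
  by have := K h; under eq_bigr do under eq_bigr do rewrite mxE.
by under eq_bigr do under eq_bigr do rewrite mxE.
Qed.

Lemma os_norm_ge0 n (x : 'M[os_mxNormed E]_n) : (0 <= mxn_norm x)%E.
Proof. exact: (opmx_norm_ge0 (@nrmZ_real H)). Qed.

Lemma os_norm_scale n (x : 'M[os_mxNormed E]_n) (c : R) : 0 < c ->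
  (mxn_norm x <= c%:E)%E ->
  (mxn_norm (map_mx ( *:%R (c^-1)%:C) x : 'M[os_mxNormed E]_n) <= 1)%E.
Proof.
move=> c0 /(os_norm_le _ (ltW c0)) xc; apply/(os_norm_le _ ler01) => h.
rewrite expr1n mul1r.
under eq_bigr => i _.
  under eq_bigr => j _ do rewrite mxE linearZ.
  rewrite [\sum_j _](_ : _ = (c^-1)%:C *: \sum_j os_emb E (x i j) (h j)); last first.
    by rewrite scaler_sumr.
  rewrite nrmZ_real ?invr_ge0 ?ltW// exprMn.
  over.
rewrite -mulr_sumr exprVn mulrC ler_pdivrMr ?exprn_gt0// mulrC.
exact: xc.
Qed.

Lemma cb_norm_le (F G : mxNormedSpace R) (u : F -> G) (c : \bar R) :
  (cb_norm u <= c)%E <->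
  forall m (y : 'M[F]_m), (mxn_norm y <= 1)%E -> (mxn_norm (map_mx u y) <= c)%E.
Proof.
split=> [uc m y y1|uc].
  apply: le_trans uc; apply: le_trans (ereal_sup_ubound _); last by exists m.
  by apply: ereal_sup_ubound; exists y.
apply: ge_ereal_sup => _ [m _ <-]; apply: ge_ereal_sup => _ [y /= y1 <-].
exact: uc.
Qed.

Variable ip : innerProduct E.

(** Evaluating the matrix of functionals attached to [x] at the entries of [y] gives an operator
    from m to m copies of C^n, with scalar entries [ip (y p q) (x i j)]. This is the Gram matrix of
    [y] and [x], once the [m] vectors of C^n are read as the rows of an m by n matrix. *)
Lemma antidual_norm_le n (x : 'M[os_mxNormed E]_n) (c : R) : 0 <= c ->
  (mxn_norm (map_mx (natural_id ip) x) <= c%:E)%E <->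
  forall m (y : 'M[os_mxNormed E]_m), (mxn_norm y <= 1)%E ->
    gram_bounded ip y x c%:C.
Proof.
move=> c0; rewrite cb_norm_le.
have K m (y : 'M[os_mxNormed E]_m) :
  (mxn_norm (map_mx (fun e : E => (\matrix_(i, j) (map_mx (natural_id ip) x) i j e)
     : matrix_mxNormed R n) y) <= c%:E)%E <-> gram_bounded ip y x c%:C.
  pose N (v : 'cV[C]_n) := dsum_norm (@nrm R C) (fun i => v i 0).
  have N0 v : 0 <= N v by exact: dsum_norm_ge0.
  have NZ a v : 0 <= a -> N (a%:C *: v) = a * N v.
    move=> a0; rewrite -dsum_normZ//; first last.
      by move=> b z b0; rewrite (nrmM b%:C z) nrm_real ger0_norm.
    by congr dsum_norm; apply/funext => i; rewrite mxE.
  have N2 v : N v ^+ 2 = \sum_i nrm (v i 0) ^+ 2.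
    by rewrite sqr_sqrtr// sumr_ge0// => i _; rewrite exprn_ge0// nrm_ge0.
  rewrite (opmx_norm_le N0 NZ _ c0); last first.
    by move=> i j a v; rewrite mxE scalemxAr.
  have gE (A : 'M[C]_(m, n)) (h : 'I_m -> 'cV[C]_n) : (forall q j, A q j = h q j 0) ->
      forall p i, gram_mx ip y x A p i = (\sum_q (map_mx (fun (a : 'M[C]_n) v => a *m v)
        (map_mx (fun e : E => \matrix_(i, j) (map_mx (natural_id ip) x) i j e) y)) p q
        (h q)) i 0.
    move=> Ah p i; rewrite mxE summxE; apply: eq_bigr => q _.
    by rewrite !mxE; apply: eq_bigr => j _; rewrite Ah !mxE.
  have fE (A : 'M[C]_(m, n)) (h : 'I_m -> 'cV[C]_n) : (forall q j, A q j = h q j 0) ->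
      fro2R A = \sum_q N (h q) ^+ 2.
    by move=> Ah; apply: eq_bigr => q _; rewrite N2; apply: eq_bigr => j _; rewrite Ah.
  rewrite gram_boundedE; split=> [yx A|yx h].
    have Ah q j : A q j = (fun q => (row q A)^T) q j 0 by rewrite !mxE.
    have := yx (fun q => (row q A)^T); rewrite -(fE _ _ Ah); apply: le_trans.
    by rewrite le_eqVlt (fE _ _ (gE _ _ Ah)) eqxx.
  pose A := \matrix_(q, j) h q j 0.
  have Ah q j : A q j = h q j 0 by rewrite mxE.
  have := yx A; rewrite -(fE _ _ Ah); apply: le_trans.
  by rewrite (fE _ _ (gE _ _ Ah)).
by split=> xc m y y1; apply/K; exact: xc.
Qed.

Lemma antidual_norm_ge0 n (x : 'M[os_mxNormed E]_n) :
  (0 <= mxn_norm (map_mx (natural_id ip) x))%E.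
Proof.
(* The empty matrix is in the unit ball, so the suprema are not over empty sets. *)
apply: le_trans (ereal_sup_ubound _); last by exists 0%N.
apply: le_trans (ereal_sup_ubound _); last first.
  exists 0 => //=; apply/(os_norm_le _ ler01) => h.
  by rewrite !big_ord0 mulr0.
rewrite /=; apply: le_trans (ereal_sup_ubound _); last first.
  by exists (fun=> 0) => //=; rewrite /dsum_norm big_ord0 sqrtr0.
by rewrite lee_fin sqrtr_ge0.
Qed.

Lemma self_antidual_norm_le n (x : 'M[os_mxNormed E]_n) (c : R) : 0 < c ->
  complete_isometry
    (natural_id ip : {linear os_mxNormed E -> antidual_mxNormed E}) ->
  (mxn_norm x <= c%:E)%E <-> gram_bounded ip x x (c ^+ 2)%:C.
Proof.
move=> c0 iso.
(* The dual norm of [z] is tested at [z / b], which lies in the unit ball, and the bound is scaled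
   back by [b]. *)
have xx k (z : 'M[os_mxNormed E]_k) (b : R) : 0 < b ->
    (mxn_norm z <= b%:E)%E -> gram_bounded ip z z (b ^+ 2)%:C.
  move=> b0 zb; have z1 := os_norm_scale b0 zb.
  have /(antidual_norm_le _ (ltW b0)) : (mxn_norm (map_mx (natural_id ip) z) <= b%:E)%E.
    by rewrite iso.
  move=> /(_ _ _ z1)/(gram_boundedZl b); rewrite expr2 -map_mx_comp.
  rewrite (_ : map_mx _ z = z)//; apply/matrixP => i j.
  by rewrite mxE /= scalerA -rmorphM divff ?gt_eqF// rmorph1 scale1r.
split; first exact: xx.
(* By [xx], a matrix [y] in the unit ball has Gram bound 1, so Haagerup's inequality bounds the
   pairing of [y] with [x] by [c]. *)
move=> xc; rewrite -iso; apply/(antidual_norm_le _ (ltW c0)) => m y y1.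
rewrite -[c]mul1r rmorphM rmorph1; apply: gram_bounded_mul => //; last first.
- by rewrite -rmorphXn.
- by rewrite expr1n; have := xx _ y 1 ltr01 y1; rewrite expr1n.
- by rewrite -(rmorph0 (real_complex R)) lecR ltW.
Qed.

(** The hypothesis identifies the unit balls with the matrices of Gram bound 1. [gram_bounded_dual]
    then bounds the norm by the dual norm, and Haagerup's inequality gives the converse. *)
Lemma self_antidual_of_norm_le :
  (forall n (x : 'M[os_mxNormed E]_n) (c : R), 0 < c ->
    (mxn_norm x <= c%:E)%E <-> gram_bounded ip x x (c ^+ 2)%:C) ->
  complete_isometry
    (natural_id ip : {linear os_mxNormed E -> antidual_mxNormed E}).
Proof.
move=> nE n x; apply: eq_ereal_bounds => [||c c0].
- exact: antidual_norm_ge0.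
- exact: os_norm_ge0.
have n1 m (y : 'M[os_mxNormed E]_m) : (mxn_norm y <= 1)%E <-> gram_bounded ip y y 1.
  by have := nE m y 1 ltr01; rewrite expr1n.
rewrite nE//; split=> [xc|xc].
  apply: gram_bounded_dual => // m y y1.
  by move/(antidual_norm_le _ (ltW c0)): xc; apply; apply/n1.
apply/(antidual_norm_le _ (ltW c0)) => m y /n1 y1.
rewrite -[c]mul1r rmorphM rmorph1; apply: gram_bounded_mul => //; last first.
- by rewrite -rmorphXn.
- by rewrite expr1n.
- by rewrite -(rmorph0 (real_complex R)) lecR ltW.
Qed.

End SelfAntidual.

(** * Uniqueness up to complete isometry *)

Section Uniqueness.
Variable R : realType.
Local Notation C := R[i].

(** Expanding at [x + y] shows that [u] preserves the sum of the form and its transpose; replacing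
    [y] by ['i *: y] gives the same for their difference. *)
Lemma dot_polarization (F : numClosedFieldType) (U V : lmodType F)
    (f : {dot U for @Num.conj F}) (g : {dot V for @Num.conj F})
    (u : {linear U -> V}) :
  (forall x, g (u x) (u x) = f x x) -> forall x y, g (u x) (u y) = f x y.
Proof.
move=> gf.
have S x y : g (u x) (u y) + g (u y) (u x) = f x y + f y x.
  have := gf (x + y); rewrite linearD !linearDl !linearDr /= !gf.
  rewrite -!addrA => /addrI; rewrite !addrA => /addIr.
  exact.
move=> x y; have D : g (u y) (u x) - g (u x) (u y) = f y x - f x y.
  have := S x ('i *: y); rewrite linearZ /= !linearZl_LR !linearZr_LR /= conjCi.
  rewrite !mulNr addrC -mulrBr [RHS]addrC -mulrBr.
  exact/mulfI/neq0Ci.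
have : g (u x) (u y) *+ 2 = f x y *+ 2.
  have E (a b : F) : a *+ 2 = (a + b) - (b - a).
    by rewrite opprB addrA addrAC addrK mulr2n.
  by rewrite (E _ (g (u y) (u x))) S D -E.
have F2 : 2%:R != 0 :> F by rewrite pnatr_eq0.
by move=> fg; apply: (mulfI F2); rewrite !mulr_natl.
Qed.

Lemma nrm_eq0 (V : normedZmodType C) (x : V) : nrm x = 0 -> x = 0.
Proof. by move=> x0; apply/normr0_eq0; rewrite -nrmE x0. Qed.

(** The two identifications with the sequence space compose to a surjective linear isometry [u]. It
    preserves inner products by polarization, hence all Gram matrices. *)
Lemma self_antidual_unique (I : Type) (H1 H2 : hilbertSpace R)
    (E1 : operatorSpace H1) (E2 : operatorSpace H2) :
  isometric_to_ell2 I E1 -> self_antidual E1 ->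
  isometric_to_ell2 I E2 -> self_antidual E2 ->
  completely_isometric (os_mxNormed E1) (os_mxNormed E2).
Proof.
move=> [T1 [n1 r1]] [ip1 iso1] [T2 [n2 r2]] [ip2 iso2].
have T2I : injective T2.
  move=> y z yz; apply/eqP; rewrite -subr_eq0; apply/eqP/nrm_eq0.
  have : ell2_norm (T2 (y - z)) = ell2_norm (T2 0).
    by rewrite linearB yz subrr linear0.
  by rewrite !n2 => -[->]; rewrite /nrm normr0.
have /choice[u uE] : forall x, exists y, T2 y = T1 x.
  move=> x; have : ell2 (T1 x) by rewrite /ell2 /= n1 ltry.
  by rewrite -r2 => -[y _ yx]; exists y.
have ulin : linear u.
  by move=> a x y; apply: T2I; rewrite linearP !uE linearP.
pose uL : {linear os_mxNormed E1 -> os_mxNormed E2} :=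
  HB.pack u (GRing.isLinear.Build C E1 E2 *:%R u ulin).
have un x : `|u x| = `|x|.
  by rewrite -!nrmE; congr (_%:C); apply: EFin_inj; rewrite -n2 -n1 uE.
have uip : forall x y, ip2 (u x) (u y) = ip1 x y.
  have : forall x, ip2 (uL x) (uL x) = ip1 x x.
    by move=> x; rewrite !ip_norm un.
  exact: dot_polarization.
exists uL; split.
  move=> y _; have : ell2 (T2 y) by rewrite /ell2 /= n2 ltry.
  by rewrite -r1 => -[x _ xy]; exists x => //; apply: T2I; rewrite -xy uE.
move=> n x; apply: eq_ereal_bounds => [||c c0]; try exact: os_norm_ge0.
(* Both matrix norms are now expressed by Gram matrices alone. *)
rewrite (self_antidual_norm_le _ c0 iso1) (self_antidual_norm_le _ c0 iso2).
suff gE A : gram_mx ip2 (map_mx uL x) (map_mx uL x) A = gram_mx ip1 x x A.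
  by split=> xc A; have := xc A; rewrite gE.
apply/matrixP => i p; rewrite !mxE; apply: eq_bigr => j _; apply: eq_bigr => q _.
by rewrite !mxE uip.
Qed.

End Uniqueness.

(** * The Hilbert space of square summable families *)

Section RealSums.
Variables (R : realType) (T : choiceType).
Implicit Types u v : T -> R.

(** A supremum of finite partial sums, so it is the sum of the family only when [u] is
    nonnegative. *)
Definition rsum u : \bar R := (\esum_(j in [set: T]) (u j)%:E)%E.

Lemma rsum_ge u (X : {fset T}) : ((\sum_(j <- X) u j)%:E <= rsum u)%E.
Proof.
apply: esum_ge; exists [set` X]; first by split.
by rewrite fsbig_finite// set_fsetK sumEFin.
Qed.

Lemma rsum_le u (M : \bar R) :
  (forall X : {fset T}, ((\sum_(j <- X) u j)%:E <= M)%E) -> (rsum u <= M)%E.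
Proof.
move=> uM; apply: ge_ereal_sup => _ [X [finX _] <-].
by rewrite fsbig_finite// sumEFin.
Qed.

Lemma rsum_ge0 u : (forall j, 0 <= u j) -> (0 <= rsum u)%E.
Proof. by move=> u0; apply: esum_ge0 => j _; rewrite lee_fin. Qed.

Lemma le_rsum u v : (forall j, u j <= v j) -> (rsum u <= rsum v)%E.
Proof. by move=> uv; apply: le_esum => j _; rewrite lee_fin. Qed.

Lemma rsumD u v : (forall j, 0 <= u j) -> (forall j, 0 <= v j) ->
  rsum (fun j => u j + v j)%R = (rsum u + rsum v)%E.
Proof. by move=> u0 v0; rewrite /rsum -esumD// => j _; rewrite lee_fin. Qed.

Lemma rsumZ (a : R) u : 0 <= a -> (forall j, 0 <= u j) ->
  rsum (fun j => a * u j)%R = (a%:E * rsum u)%E.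
Proof.
have H (b : R) w : 0 < b -> (rsum (fun j => b * w j)%R <= b%:E * rsum w)%E.
  move=> b0; apply: rsum_le => X; rewrite -mulr_sumr EFinM.
  by rewrite lee_pmul2l// rsum_ge.
rewrite le_eqVlt => /orP[/eqP<- _|a0 u0].
  by rewrite mul0e /rsum esum1// => j _; rewrite mul0r.
apply/le_anti/andP; split; first exact: H.
(* The reverse inequality is [H] with the factor [a^-1] and the family [a * u]. *)
have a'0 : 0 < a^-1 by rewrite invr_gt0.
have := H _ (fun j => a * u j) a'0.
under [X in (rsum X <= _)%E]funext => j do rewrite mulKf ?gt_eqF//.
have a0E : (0 <= a%:E)%E by rewrite lee_fin ltW.
move=> /(lee_wpmul2l a0E).
by rewrite muleA -EFinM divff ?gt_eqF// mul1e.
Qed.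

Definition summable_real u := (rsum (fun j => `|u j|)%R < +oo)%E.

(* Subtracting [|u|] from [|u| + u] reduces signed sums to nonnegative ones. *)
Definition ssum u : R :=
  fine (rsum (fun j => `|u j| + u j)%R) - fine (rsum (fun j => `|u j|)%R).

Lemma fin_rsum u : (forall j, 0 <= u j) -> (rsum u < +oo)%E ->
  (fine (rsum u))%:E = rsum u.
Proof. by move=> u0 uoo; rewrite fineK// ge0_fin_numE// rsum_ge0. Qed.

Lemma summable_le u v : (forall j, `|u j| <= v j) -> (rsum v < +oo)%E ->
  summable_real u.
Proof. by move=> uv; apply: le_lt_trans; exact: le_rsum. Qed.

Lemma normrD_ge0 (x : R) : 0 <= `|x| + x.
Proof. by rewrite -lerBlDr sub0r ler_normr lexx orbT. Qed.

Lemma summable_shift u : summable_real u -> (rsum (fun j => `|u j| + u j)%R < +oo)%E.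
Proof.
move=> uoo; apply: (@le_lt_trans _ _ (rsum (fun j => `|u j| + `|u j|)%R)).
  by apply: le_rsum => j; rewrite lerD2l ler_norm.
by rewrite rsumD// lte_add_pinfty.
Qed.

Lemma summableD_real u v : summable_real u -> summable_real v ->
  summable_real (fun j => u j + v j).
Proof.
move=> uoo voo; apply: (@summable_le _ (fun j => `|u j| + `|v j|)).
  by move=> j; exact: ler_normD.
by rewrite rsumD// lte_add_pinfty.
Qed.

Lemma ssumD u v : summable_real u -> summable_real v ->
  ssum (fun j => u j + v j) = ssum u + ssum v.
Proof.
move=> uoo voo; have uvoo := summableD_real uoo voo.
have n0 := normrD_ge0.
(* All six families are nonnegative, so [rsumD] applies to this pointwise identity; the sums are
   finite, so terms can then be moved across. *)
have : (rsum (fun j => `|(u j + v j)%R| + (u j + v j))%R +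
    (rsum (fun j => `|u j|)%R + rsum (fun j => `|v j|)%R) =
    rsum (fun j => `|(u j + v j)%R|)%R +
    (rsum (fun j => `|u j| + u j)%R + rsum (fun j => `|v j| + v j)%R))%E.
  rewrite -!rsumD//; try by move=> j; rewrite addr_ge0.
  by congr rsum; apply/funext => j; ring.
have N w : summable_real w -> rsum (fun j => `|w j|)%R = (fine (rsum (fun j => `|w j|)%R))%:E.
  by move=> woo; rewrite fin_rsum.
have P w : summable_real w ->
    rsum (fun j => `|w j| + w j)%R = (fine (rsum (fun j => `|w j| + w j)%R))%:E.
  by move=> woo; rewrite fin_rsum ?summable_shift.
rewrite (N u)// (N v)// (N _ uvoo) (P u)// (P v)// (P _ uvoo) -!EFinD; case=> E.
by rewrite /ssum; lra.
Qed.

Lemma ge0_ssum u : (forall j, 0 <= u j) -> (rsum u < +oo)%E ->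
  ssum u = fine (rsum u).
Proof.
move=> u0 uoo; rewrite /ssum.
have -> : (fun j => `|u j|) = u by apply/funext => j; rewrite ger0_norm.
have -> : (fun j => `|u j| + u j) = (fun j => u j + u j).
  by apply/funext => j; rewrite ger0_norm.
by rewrite rsumD// -fin_rsum// -EFinD /= addrK.
Qed.

Lemma ssum0 : ssum (fun=> 0) = 0.
Proof. by rewrite ge0_ssum /rsum ?esum1. Qed.

Lemma summableZ_real (a : R) u : summable_real u -> summable_real (fun j => a * u j).
Proof.
rewrite /summable_real => uoo; under [X in rsum X]funext do rewrite normrM.
by rewrite rsumZ// -fin_rsum// -EFinM ltry.
Qed.

Lemma ssumZ (a : R) u : summable_real u -> ssum (fun j => a * u j) = a * ssum u.
Proof.
have P (b : R) : 0 <= b -> summable_real u -> ssum (fun j => b * u j) = b * ssum u.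
  move=> b0 uoo; rewrite /ssum.
  under [X in fine (rsum X) - _]funext do rewrite normrM ger0_norm// -mulrDr.
  under [X in _ - fine (rsum X) = _]funext do rewrite normrM ger0_norm//.
  have F w : (forall j, 0 <= w j) -> (rsum w < +oo)%E ->
      fine (b%:E * rsum w) = b * fine (rsum w).
    by move=> w0 woo; rewrite -{1}(fin_rsum w0 woo).
  rewrite !rsumZ//; last by move=> j; exact: normrD_ge0.
  rewrite !F//; first by rewrite mulrBr.
    by move=> j; exact: normrD_ge0.
  exact: summable_shift.
have [a0|a0] := leP 0 a; first exact: P.
move=> uoo; have a'0 : 0 <= - a by rewrite oppr_ge0 ltW.
(* A negative factor reduces to its opposite by additivity. *)
have : ssum (fun j => a * u j + (- a) * u j) = 0.
  by rewrite -ssum0; congr ssum; apply/funext => j; rewrite mulNr subrr.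
rewrite ssumD ?(P (- a))//; try exact: summableZ_real.
by rewrite mulNr => /eqP; rewrite subr_eq0 => /eqP.
Qed.

End RealSums.

(** * Absolutely summable complex families *)

Section ComplexSums.
Variables (R : realType) (T : choiceType).
Local Notation C := R[i].
Implicit Types g h : T -> C.

Lemma nrm2E (z : C) : nrm z ^+ 2 = complex.Re z ^+ 2 + complex.Im z ^+ 2.
Proof. by rewrite /nrm normc_def /= sqr_sqrtr// addr_ge0 ?sqr_ge0. Qed.

Lemma Re_le_nrm (z : C) : `|complex.Re z| <= nrm z.
Proof.
rewrite -(@ler_pXn2r _ 2) ?nnegrE ?nrm_ge0// real_normK ?num_real//.
by rewrite nrm2E lerDl sqr_ge0.
Qed.

Lemma Im_le_nrm (z : C) : `|complex.Im z| <= nrm z.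
Proof.
rewrite -(@ler_pXn2r _ 2) ?nnegrE ?nrm_ge0// real_normK ?num_real//.
by rewrite nrm2E lerDr sqr_ge0.
Qed.

Definition csummable g := (rsum (fun j => nrm (g j))%R < +oo)%E.

Definition csum g : C :=
  (ssum (fun j => complex.Re (g j)) +i* ssum (fun j => complex.Im (g j)))%C.

Lemma csumP (a : C) g h : csummable g -> csummable h ->
  csum (fun j => a * g j + h j) = a * csum g + csum h.
Proof.
move=> goo hoo.
have rg : summable_real (fun j => complex.Re (g j)).
  by apply: summable_le goo => j; exact: Re_le_nrm.
have ig : summable_real (fun j => complex.Im (g j)).
  by apply: summable_le goo => j; exact: Im_le_nrm.
have rh : summable_real (fun j => complex.Re (h j)).
  by apply: summable_le hoo => j; exact: Re_le_nrm.
have ih : summable_real (fun j => complex.Im (h j)).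
  by apply: summable_le hoo => j; exact: Im_le_nrm.
have L (p q : R) u v w : summable_real u -> summable_real v -> summable_real w ->
    ssum (fun j : T => p * u j + q * v j + w j) = p * ssum u + q * ssum v + ssum w.
  move=> su sv sw; have pu := summableZ_real p su; have qv := summableZ_real q sv.
  by rewrite (ssumD (summableD_real pu qv) sw) (ssumD pu qv) !ssumZ.
case: a => p q; rewrite /csum.
have -> : (fun j => complex.Re ((p +i* q)%C * g j + h j)) =
    (fun j => (p * complex.Re (g j) + - q * complex.Im (g j)) + complex.Re (h j)).
  by apply/funext => j; case: (g j) => a b; case: (h j) => c d /=; rewrite mulNr.
have -> : (fun j => complex.Im ((p +i* q)%C * g j + h j)) =
    (fun j => (p * complex.Im (g j) + q * complex.Re (g j)) + complex.Im (h j)).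
  by apply/funext => j; case: (g j) => a b; case: (h j) => c d /=.
rewrite !L//.
by apply/eqP; rewrite eq_complex /= mulNr !eqxx.
Qed.

Lemma csum_conj g : csummable g -> csum (fun j => Num.conj (g j)) = Num.conj (csum g).
Proof.
move=> goo.
have ig : summable_real (fun j => complex.Im (g j)).
  by apply: summable_le goo => j; exact: Im_le_nrm.
rewrite /csum.
have -> : (fun j => complex.Re (Num.conj (g j))) = (fun j => complex.Re (g j)).
  by apply/funext => j; case: (g j).
have -> : (fun j => complex.Im (Num.conj (g j))) = (fun j => -1 * complex.Im (g j)).
  by apply/funext => j; case: (g j) => a b /=; rewrite mulN1r.
by rewrite ssumZ// mulN1r.
Qed.

Lemma csum_real (u : T -> R) : (forall j, 0 <= u j) -> (rsum u < +oo)%E ->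
  csum (fun j => (u j)%:C) = (fine (rsum u))%:C.
Proof.
move=> u0 uoo; rewrite /csum /= ssum0.
by rewrite -(ge0_ssum u0 uoo).
Qed.

Lemma nrm_conj (z : C) : nrm (Num.conj z) = nrm z.
Proof. by apply: complexI; rewrite !nrmE norm_conjC. Qed.

Lemma nrmD_sqr (V : normedZmodType C) (x y : V) :
  nrm (x + y) ^+ 2 <= 2 * nrm x ^+ 2 + 2 * nrm y ^+ 2.
Proof.
have H : nrm (x + y) <= nrm x + nrm y.
  by rewrite -lecR rmorphD /= !nrmE ler_normD.
apply: (@le_trans _ _ ((nrm x + nrm y) ^+ 2)).
  by rewrite ler_pXn2r ?nnegrE ?addr_ge0 ?nrm_ge0.
by have := sqr_ge0 (nrm x - nrm y); nra.
Qed.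

End ComplexSums.

(** * The inner product space of square summable families *)

Section SquareSummable.
Variables (R : realType) (J : Type).
Local Notation C := R[i].

Definition sqsum (f : J -> C) : \bar R :=
  @rsum R {classic J} (fun j => nrm (f j) ^+ 2).

Lemma sqsum_ge0 f : (0 <= sqsum f)%E.
Proof. by apply: rsum_ge0 => j; exact: sqr_ge0. Qed.

Lemma sqsumZ (a : C) f : sqsum (fun j => a * f j) = ((nrm a ^+ 2)%:E * sqsum f)%E.
Proof.
rewrite /sqsum -rsumZ ?sqr_ge0//; last by move=> j; exact: sqr_ge0.
by congr rsum; apply/funext => j; rewrite nrmM exprMn.
Qed.

(** A crude substitute for the triangle inequality, available before the inner product and enough
    for closure under addition. *)
Lemma sqsumD f g : (sqsum (fun j => (f j + g j)%R) <= 2%:E * sqsum f + 2%:E * sqsum g)%E.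
Proof.
rewrite /sqsum -!rsumZ//; try by move=> j; exact: sqr_ge0.
rewrite -rsumD; try by move=> j; rewrite mulr_ge0 ?sqr_ge0.
by apply: le_rsum => j; exact: (nrmD_sqr (f j : C) (g j : C)).
Qed.

Definition square_summable : {pred J -> R[i]^o} :=
  fun f : J -> R[i]^o => `[< (sqsum f < +oo)%E >].

Record l2 := L2 { l2fun :> J -> R[i]^o ; l2funP : l2fun \in square_summable }.

HB.instance Definition _ := [isSub for l2fun].
HB.instance Definition _ := [Choice of l2 by <:].

Lemma square_summable_submod : submod_closed square_summable.
Proof.
split=> [|a f g /asboolP foo /asboolP goo].
  apply/asboolP; rewrite /sqsum /rsum esum1 ?ltry// => j _.
  by rewrite /nrm normr0 expr0n.
apply/asboolP; apply: (le_lt_trans (sqsumD (fun j => a * f j) g)).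
rewrite sqsumZ lte_add_pinfty//.
  by rewrite muleA -EFinM lte_mul_pinfty// lee_fin mulr_ge0 ?sqr_ge0.
by rewrite lte_mul_pinfty// lee_fin.
Qed.

HB.instance Definition _ :=
  GRing.isSubmodClosed.Build R[i] (J -> R[i]^o) square_summable
    square_summable_submod.
HB.instance Definition _ := [SubChoice_isSubLmodule of l2 by <:].

Implicit Types f g h : l2.

Lemma l2_fin f : (sqsum f < +oo)%E.
Proof. by have /asboolP := l2funP f. Qed.

Lemma l2P (a : C) f g j : (a *: f + g) j = a * f j + g j :> C.
Proof. by []. Qed.

Definition sqnorm f : R := fine (sqsum f).

Lemma sqnormE f : (sqnorm f)%:E = sqsum f.
Proof. by rewrite fineK// ge0_fin_numE ?l2_fin// sqsum_ge0. Qed.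

Lemma sqnorm_ge0 f : 0 <= sqnorm f.
Proof. by rewrite -lee_fin sqnormE sqsum_ge0. Qed.

Definition l2_dot f g : C :=
  @csum R {classic J} (fun j => (f j : C) * Num.conj (g j : C)).

Lemma csummable_dot f g :
  @csummable R {classic J} (fun j => (f j : C) * Num.conj (g j : C)).
Proof.
apply: (@le_lt_trans _ _ (sqsum f + sqsum g)%E); last first.
  by rewrite lte_add_pinfty ?l2_fin.
rewrite /sqsum -rsumD; try by move=> j; exact: sqr_ge0.
apply: le_rsum => j; rewrite nrmM nrm_conj.
have := nrm_ge0 (f j : C); have := nrm_ge0 (g j : C).
by move: (nrm _) (nrm _) => a b; nra.
Qed.

Lemma l2_dotPl (a : C) f g h : l2_dot (a *: f + g) h = a * l2_dot f h + l2_dot g h.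
Proof.
rewrite /l2_dot -csumP; try exact: csummable_dot.
by congr csum; apply/funext => j; rewrite l2P mulrDl mulrA.
Qed.

Lemma l2_dot_herm f g : l2_dot f g = (-1) ^+ false * Num.conj (l2_dot g f).
Proof.
rewrite expr0 mul1r /l2_dot -csum_conj; last exact: csummable_dot.
by congr csum; apply/funext => j; rewrite [RHS]rmorphM /= conjCK mulrC.
Qed.

Lemma l2_dotPr (a : C) f g h :
  l2_dot f (a *: g + h) = Num.conj a * l2_dot f g + l2_dot f h.
Proof.
rewrite l2_dot_herm l2_dotPl [l2_dot f g]l2_dot_herm [l2_dot f h]l2_dot_herm.
by rewrite !expr0 !mul1r rmorphD rmorphM.
Qed.

Lemma l2_dot_bilinear : bilinear_for (GRing.Scale.Law.clone _ _ *%R _)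
  (GRing.Scale.Law.clone _ _ (Num.conj \; *%R) _) l2_dot.
Proof. by split=> y a x z; rewrite ?l2_dotPr ?l2_dotPl. Qed.

HB.instance Definition _ := @bilinear_isBilinear.Build R[i] l2 l2 R[i] *%R
  (Num.conj \; *%R) l2_dot l2_dot_bilinear.

HB.instance Definition _ := @isHermitianSesquilinear.Build R[i] l2
  false Num.conj l2_dot l2_dot_herm.

Lemma l2_dot_sqr f : l2_dot f f = (sqnorm f)%:C.
Proof.
rewrite /sqnorm /sqsum -csum_real; last exact: l2_fin; last first.
  by move=> j; exact: sqr_ge0.
by congr csum; apply/funext => j; rewrite nrm_sqr normCK.
Qed.

Lemma nrm_coord_le f j : nrm (f j : C) ^+ 2 <= sqnorm f.
Proof.
rewrite -lee_fin sqnormE /sqsum.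
have := @rsum_ge R {classic J} (fun j => nrm (f j : C) ^+ 2) [fset (j : {classic J})]%fset.
by rewrite big_seq_fset1.
Qed.

Lemma sqnorm_eq0 f : sqnorm f = 0 -> f = 0.
Proof.
move=> f0; apply: val_inj; apply/funext => j; apply: nrm_eq0.
have := nrm_coord_le f j; rewrite f0 => H.
by apply/eqP; rewrite -sqrf_eq0 eq_le H sqr_ge0.
Qed.

Lemma l2_dot_gt0 f : f != 0 -> 0 < l2_dot f f.
Proof.
move=> f0; rewrite l2_dot_sqr -(rmorph0 (real_complex R)) ltcR.
rewrite lt_def sqnorm_ge0 andbT; apply: contra f0 => /eqP/sqnorm_eq0 ->.
by [].
Qed.

HB.instance Definition _ := @isDotProduct.Build R[i] l2 l2_dot l2_dot_gt0.

Definition l2_norm f : C := (Num.sqrt (sqnorm f))%:C.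

Lemma l2_norm_sqr f : l2_norm f ^+ 2 = l2_dot f f.
Proof. by rewrite l2_dot_sqr -rmorphXn /= sqr_sqrtr ?sqnorm_ge0. Qed.

Lemma l2_norm_ge0 f : 0 <= l2_norm f.
Proof. by rewrite -(rmorph0 (real_complex R)) lecR sqrtr_ge0. Qed.

Lemma l2_normD f g : l2_norm (f + g) <= l2_norm f + l2_norm g.
Proof.
rewrite -(@ler_pXn2r _ 2) ?nnegrE ?addr_ge0 ?l2_norm_ge0//.
rewrite sqrrD !l2_norm_sqr [leRHS]addrAC.
have -> := dnormD (l2_dot : {dot l2 for @Num.conj C}) f g.
rewrite lerD2l; set d := l2_dot f g.
have dr : d + Num.conj d \is Num.real by apply/CrealP; rewrite rmorphD /= conjCK addrC.
rewrite (le_trans (real_ler_norm dr))// (le_trans (ler_normD _ _))//.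
rewrite norm_conjC -mulr2n lerMn2r /=.
rewrite -(@ler_pXn2r _ 2) ?nnegrE ?mulr_ge0 ?l2_norm_ge0// exprMn !l2_norm_sqr.
exact: (dot_cauchy_schwarz (l2_dot : {dot l2 for @Num.conj C})).
Qed.

Lemma l2_normZ (a : C) f : l2_norm (a *: f) = `|a| * l2_norm f.
Proof.
rewrite /l2_norm /sqnorm -nrmE -rmorphM; congr (_%:C) => /=.
have -> : sqsum (a *: f) = ((nrm a ^+ 2)%:E * sqsum f)%E by rewrite -sqsumZ.
rewrite -sqnormE -EFinM /= sqrtrM ?sqr_ge0//.
by rewrite sqrtr_sqr ger0_norm ?nrm_ge0.
Qed.

Lemma l2_norm_eq0 f : l2_norm f = 0 -> f = 0.
Proof.
move=> f0; apply: sqnorm_eq0; apply: (@complexI R).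
by rewrite -l2_dot_sqr -l2_norm_sqr f0 expr0n.
Qed.

HB.instance Definition _ :=
  @Lmodule_isNormed.Build R[i] l2 l2_norm l2_normD l2_normZ l2_norm_eq0.

Lemma nrm_l2 f : nrm f = Num.sqrt (sqnorm f).
Proof. by apply: (@complexI R); rewrite nrmE. Qed.

Lemma nrm_l2_sqr f : nrm f ^+ 2 = sqnorm f.
Proof. by rewrite nrm_l2 sqr_sqrtr// sqnorm_ge0. Qed.

Lemma coord_le f j : nrm (f j : C) <= nrm f.
Proof.
rewrite -(@ler_pXn2r _ 2) ?nnegrE ?nrm_ge0//.
by rewrite nrm_l2_sqr nrm_coord_le.
Qed.

End SquareSummable.
Arguments l2 R J : clear implicits.


(** * Completeness of the space of square summable families *)

Section L2Complete.
Variables (R : realType) (J : Type).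
Local Notation C := R[i].
Local Notation l2 := (l2 R J).

(** Used with [p] the real and the imaginary part: [p] of a coordinate is dominated by the norm, so
    a Cauchy filter has a Cauchy image in [R]. *)
Lemma real_coord_cvg (F : set_system l2) (p : C -> R) :
  (forall z w, p (z - w) = p z - p w) -> (forall z, `|p z| <= nrm z) ->
  ProperFilter F -> cauchy F -> forall j, exists r : R,
  forall e : R, 0 < e -> F [set f : l2 | `|p (f j : C) - r| < e].
Proof.
move=> pB pn FF Fc j.
have PF : ProperFilter ((fun f : l2 => p (f j : C)) @ F) by exact: fmap_proper_filter.
have : cvg ((fun f : l2 => p (f j : C)) @ F).
  apply: cauchy_cvg; apply: cauchy_exP => e e0.
  have /cauchyP/(_ e%:C)[] : cauchy F by [].
    by rewrite -(rmorph0 (real_complex R)) ltcR.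
  move=> f0 Ff; exists (p (f0 j : C)).
  suff H : ball f0 e%:C `<=` [set f : l2 | ball (p (f0 j : C)) e (p (f j : C))].
    exact: filterS H Ff.
  move=> f /=; rewrite -ball_normE /ball_ /= -nrmE ltcR => ff0.
  rewrite -ball_normE /ball_ /= -pB; apply: le_lt_trans ff0.
  by apply: le_trans (pn _) _; exact: (coord_le (f0 - f)).
move=> /cvg_ex[r /cvgrPdist_lt Fr]; exists r => e e0.
by under eq_set do rewrite distrC; exact: Fr.
Qed.

Lemma l2_complete (F : set_system l2) : ProperFilter F -> cauchy F -> cvg F.
Proof.
move=> FF Fc.
have ReB (z w : C) : complex.Re (z - w) = complex.Re z - complex.Re w.
  by case: z; case: w.
have ImB (z w : C) : complex.Im (z - w) = complex.Im z - complex.Im w.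
  by case: z; case: w.
have /choice[gr grP] := real_coord_cvg ReB (@Re_le_nrm R) FF Fc.
have /choice[gi giP] := real_coord_cvg ImB (@Im_le_nrm R) FF Fc.
pose g : J -> R[i]^o := fun j => (gr j +i* gi j)%C.
have gP (e : R) j : 0 < e -> F [set f : l2 | nrm (f j - g j : C) ^+ 2 < e].
  move=> e0.
  have d0 : 0 < Num.sqrt (e / 2) by rewrite sqrtr_gt0 divr_gt0.
  have := grP j _ d0; have := giP j _ d0; apply: filterS2 => f fi fr.
  rewrite /= in fi fr *; rewrite nrm2E ReB ImB [e]splitr.
  have S x : `|x| < Num.sqrt (e / 2) -> x ^+ 2 < e / 2.
    move=> xe; rewrite -(real_normK (num_real x)) -[ltRHS]sqr_sqrtr ?divr_ge0 ?ltW//.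
    by rewrite ltr_pXn2r ?nnegrE ?sqrtr_ge0.
  by rewrite ltrD// S.
(* On a finite [X], some [f] in [A] is close to [g] in all coordinates of [X]; comparing [h] with
   [f] and [f] with [g] gives a bound independent of [X]. *)
have key (e : R) (A : set l2) h : 0 < e -> F A -> A h ->
    (forall f, A f -> nrm (h - f) <= e) ->
    (sqsum (fun j => (h j - g j : C)%R) <= (4 * e ^+ 2)%:E)%E.
  move=> e0 FA Ah hA; apply: rsum_le => X.
  (* The error [e ^+ 2] is shared among the coordinates in [X]; the successor avoids dividing by
     zero. *)
  pose d := e ^+ 2 / (size X).+1%:R.
  have d0 : 0 < d by rewrite divr_gt0 ?exprn_gt0.
  have FX : F (\bigcap_(j in [set` X]) [set f : l2 | nrm (f j - g j : C) ^+ 2 < d]).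
    by apply: filter_bigI => j _; exact: gP.
  have [f [Af fX]] := filter_ex (filterI FA FX).
  rewrite lee_fin.
  apply: (@le_trans _ _ (\sum_(j <- X) (2 * nrm ((h - f) j : C) ^+ 2 +
      2 * nrm (f j - g j : C) ^+ 2))).
    apply: ler_sum => j _.
    have -> : (h j - g j : C) = ((h - f) j : C) + (f j - g j : C).
      by rewrite -[(h - f) j]/(h j - f j : C) addrA subrK.
    exact: nrmD_sqr.
  rewrite big_split /= -!mulr_sumr.
  have S1 : \sum_(j <- X) nrm ((h - f) j : C) ^+ 2 <= e ^+ 2.
    apply: (@le_trans _ _ (sqnorm (h - f))).
      rewrite -lee_fin sqnormE.
      exact: (@rsum_ge R {classic J} (fun j => nrm ((h - f) j : C) ^+ 2) X).
    by rewrite -nrm_l2_sqr ler_pXn2r ?nnegrE ?nrm_ge0 ?(ltW e0)// hA.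
  have S2 : \sum_(j <- X) nrm (f j - g j : C) ^+ 2 <= e ^+ 2.
    apply: (@le_trans _ _ (\sum_(j <- X) d)).
      rewrite big_seq [leRHS]big_seq; apply: ler_sum => j jX.
      by apply/ltW/fX.
    rewrite big_const_seq count_predT iter_addr_0 -mulr_natr.
    rewrite /d -mulrA ler_piMr ?sqr_ge0// ler_pdivrMl// mulr1 ler_nat.
    exact: leqnSn.
  by lra.
have ex (e : R) : 0 < e -> exists f0 : l2, F (ball f0 e%:C).
  move=> e0; have /cauchyP/(_ e%:C)[|f0 Ff0] : cauchy F by []; last by exists f0.
  by rewrite -(rmorph0 (real_complex R)) ltcR.
have ballD (e : R) (f0 h f : l2) : ball f0 e%:C h -> ball f0 e%:C f -> nrm (h - f) <= 2 * e.
  rewrite -ball_normE /ball_ /= -!nrmE !ltcR => hf ff.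
  rewrite -lecR nrmE -(subrK f0 h) -addrA (le_trans (ler_normD _ _))//.
  by rewrite -normrN opprB -!nrmE -rmorphD lecR /= mulrDl mul1r; apply/ltW/ltrD.
have hg (e : R) (f0 h : l2) : 0 < e -> F (ball f0 e%:C) -> ball f0 e%:C h ->
    (sqsum (fun j => (h j - g j : C)%R) <= ((4 * e) ^+ 2)%:E)%E.
  move=> e0 Ff0 hf0; have e20 : 0 < 2 * e by rewrite mulr_gt0.
  have := key _ _ h e20 Ff0 hf0 (fun f => ballD _ _ _ _ hf0).
  by rewrite [4 * (2 * e) ^+ 2](_ : _ = (4 * e) ^+ 2)//; ring.
have g2 : g \in @square_summable R J.
  have [f0 Ff0] := ex 1 ltr01.
  have [h hf0] := filter_ex Ff0.
  have hgoo : (sqsum (fun j => (h j - g j : C)%R) < +oo)%E.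
    by apply: le_lt_trans (hg _ _ _ ltr01 Ff0 hf0) _; rewrite ltry.
  apply/asboolP.
  have -> : g = (fun j => (h j : C) + -1 * (h j - g j : C)).
    by apply/funext => j; rewrite mulN1r opprB addrC subrK.
  apply: le_lt_trans (sqsumD h (fun j => -1 * (h j - g j : C))) _.
  rewrite sqsumZ lte_add_pinfty//.
    by rewrite lte_mul_pinfty ?l2_fin// lee_fin.
  by rewrite muleA -EFinM lte_mul_pinfty// lee_fin mulr_ge0 ?sqr_ge0.
apply/cvg_ex; exists (L2 g2) => A /nbhs_ballP[e /= e0 yA].
have er : e \is Num.real by exact: gtr0_real.
have eE : (complex.Re e)%:C = e by rewrite RRe_real.
move: e0 yA; rewrite -eE -(rmorph0 (real_complex R)) ltcR => e0 yA.
(* [hg] multiplies the radius by 4, so a fifth of it leaves a strict inequality. *)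
have d0 : 0 < complex.Re e / 5 by rewrite divr_gt0.
have [f0 Ff0] := ex _ d0.
apply: filterS (Ff0) => h hf0; apply: yA.
rewrite -ball_normE /ball_ /= -normrN opprB -nrmE ltcR.
apply: (@le_lt_trans _ _ (4 * (complex.Re e / 5))); last by lra.
rewrite -(@ler_pXn2r _ 2) ?nnegrE ?nrm_ge0//; last by lra.
rewrite nrm_l2_sqr -lee_fin sqnormE.
exact: (hg _ f0).
Qed.

HB.instance Definition _ := Uniform_isComplete.Build l2 l2_complete.

Definition l2_innerProduct : innerProduct l2 :=
  @InnerProduct R l2 (@l2_dot R J) (fun x => esym (l2_norm_sqr x)).

Definition l2_hilbertSpace : hilbertSpace R := @HilbertSpace R l2 l2_innerProduct.

Lemma isometric_l2 : isometric_to_ell2 J l2.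
Proof.
have lin : linear (@l2fun R J : l2 -> (J -> C^o)) by [].
pose T : {linear l2 -> (J -> C^o)} := HB.pack (@l2fun R J : l2 -> (J -> C^o))
  (GRing.isLinear.Build C l2 (J -> C^o) *:%R (@l2fun R J) lin).
exists T.
have nE (f : J -> C) : ell2_norm f = (sqsum f `^ 2^-1)%E by [].
split=> [f|].
  by rewrite nE -sqnormE /= powR12_sqrt ?sqnorm_ge0// nrm_l2.
apply/seteqP; split=> [_ [f _ <-]|f].
  by rewrite /ell2 /= nE poweR_lty// l2_fin.
rewrite /ell2 /= nE => foo.
have f2 : (f : J -> C^o) \in @square_summable R J.
  by apply/asboolP; apply: lty_poweRy foo; rewrite invr_eq0 pnatr_eq0.
by exists (L2 f2).
Qed.

End L2Complete.

(** * The direct sum over all contractive blocks *)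

Section Existence.
Variables (R : realType) (E : completeNormedModType R[i]) (ip : innerProduct E).
Local Notation C := R[i].
Implicit Types (n m p q : nat).

Record block := Block {
  block_size : nat ;
  block_mx :> 'M[E]_block_size ;
  block_bounded : gram_bounded ip block_mx block_mx 1 }.

Local Notation J := ({classic block} * nat)%type.

(* The direct sum over all [y] with [gram_bounded ip y y 1] of the maps
   [x |-> (ip x (y p q))_(p, q)].  A block of size [m] acts on [l2 nat] through
   the first [m] coordinates. *)
Definition raw_op (x : E) (h : J -> C) (k : J) : C :=
  if insub k.2 is Some p then
    \sum_(q < block_size k.1) ip x ((k.1 : block) p q) * h (k.1, val q)
  else 0.

Lemma rsum_ord (u : nat -> R) m : (forall p, 0 <= u p) ->
  (forall p, (m <= p)%N -> u p = 0) -> rsum u = (\sum_(p < m) u p)%:E.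
Proof.
move=> u0 um; rewrite -sumEFin.
rewrite (@fsbig_ord _ _ _ m (fun p => (u p)%:E)) -esum_fset//; last first.
  by move=> i _; rewrite lee_fin.
rewrite [RHS]esum_mkcond; apply: eq_esum => p _; case: ifPn => //.
by rewrite notin_setE /= => /negP; rewrite -leqNgt => /um ->.
Qed.

Lemma sum_le_rsum (u : nat -> R) m : (forall p, 0 <= u p) ->
  ((\sum_(p < m) u p)%:E <= rsum u)%E.
Proof.
move=> u0; rewrite (_ : \sum_(p < m) u p = \sum_(p < m) (if (p < m)%N then u p else 0)).
  rewrite -(@rsum_ord (fun p => if (p < m)%N then u p else 0)).
  - by apply: le_rsum => p; case: ifP.
  - by move=> p; case: ifP.
  - by move=> p; rewrite leqNgt => /negPf ->.
by apply: eq_bigr => p _; rewrite ltn_ord.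
Qed.

(** Sums of nonnegative terms may be regrouped block by block. *)
Lemma sum_sqsum n (f : 'I_n -> J -> C) :
  (\sum_i sqsum (f i) =
   \esum_(b in [set: {classic block}])
     \sum_i rsum (fun p => nrm (f i (b, p)) ^+ 2)%R)%E.
Proof.
rewrite esum_sum; last by move=> b i _ _; apply: rsum_ge0 => p; exact: sqr_ge0.
apply: eq_bigr => i _; rewrite /sqsum /rsum esum_esum; last first.
  by move=> b p _ _; rewrite lee_fin sqr_ge0.
rewrite (_ : _ `*`` _ = setT); last by apply/seteqP; split.
(* [sqsum] runs over [{classic J}] and the double sum over the product [J]; the reindexing map is
   the identity. *)
rewrite (reindex_esum setT setT (fun k : {classic J} => k : J)).
  by apply: eq_esum => -[b p].
split; [by []|by move=> k l _ _|by move=> k _; exists k].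
Qed.

Lemma raw_block n (x : 'M[E]_n) (h : 'I_n -> J -> C) (b : {classic block}) :
  (\sum_i rsum (fun p => nrm (\sum_j raw_op (x i j) (h j) (b, p)) ^+ 2)%R =
   (fro2R (gram_mx ip x (b : block) (\matrix_(j, q) h j (b, val q))))%:E)%E.
Proof.
rewrite /fro2R -sumEFin; apply: eq_bigr => i _.
rewrite (@rsum_ord _ (block_size b)).
- congr (_%:E); apply: eq_bigr => p _; rewrite mxE; congr (nrm _ ^+ 2).
  apply: eq_bigr => j _; rewrite /raw_op /= valK.
  by apply: eq_bigr => q _; rewrite mxE.
- by move=> p; exact: sqr_ge0.
- move=> p mp; rewrite big1 ?/nrm ?normr0 ?expr0n// => j _.
  by rewrite /raw_op /= insubF// ltnNge mp.
Qed.

(** The blocks act on disjoint sets of coordinates, so a bound common to all blocks bounds the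
    direct sum. Coordinates of [h] beyond the size of a block only enlarge the right side. *)
Lemma raw_op_le n (x : 'M[E]_n) (c : R) :
  (forall b : block, gram_bounded ip x b c%:C) -> forall h : 'I_n -> J -> C,
  (\sum_i sqsum (fun k => (\sum_j raw_op (x i j) (h j) k)%R) <=
   (c ^+ 2)%:E * \sum_i sqsum (h i))%E.
Proof.
move=> xc h; rewrite !sum_sqsum.
under [X in (X <= _)%E]eq_esum do rewrite raw_block.
apply: (@le_trans _ _ (rsum (fun b : {classic block} => c ^+ 2 *
    fro2R (\matrix_(j < n, q < block_size b) h j (b, val q)))%R)).
  by apply: le_rsum => b; move/gram_boundedE: (xc b); apply.
rewrite rsumZ ?sqr_ge0//; last by move=> b; exact: fro2R_ge0.
rewrite lee_wpmul2l ?lee_fin ?sqr_ge0//; apply: le_esum => b _.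
rewrite /fro2R -sumEFin; apply: lee_sum => i _.
rewrite (eq_bigr (fun q : 'I__ => nrm (h i (b, val q)) ^+ 2)).
  by apply: (sum_le_rsum _ (fun p => sqr_ge0 (nrm (h i (b, p))))).
by move=> q _; rewrite mxE.
Qed.

Lemma gram_bounded1 (x : E) : gram_bounded ip (const_mx x : 'M[_]_1) (const_mx x : 'M[_]_1)
  (nrm x ^+ 2)%:C.
Proof.
move=> A; rewrite /fro2 !big_ord1 mxE !big_ord1 !mxE normrM exprMn ip_norm.
by rewrite normrX normr_id -nrmE -rmorphXn.
Qed.

(** The case of one row and one column: Haagerup's inequality bounds the Gram matrix of [x] and a
    block by [nrm x]. *)
Lemma raw_op_bounded (x : E) (h : J -> C) :
  (sqsum (raw_op x h) <= (nrm x ^+ 2)%:E * sqsum h)%E.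
Proof.
have := @raw_op_le 1 (const_mx x) (nrm x) _ (fun=> h).
rewrite !big_ord1.
under [X in sqsum X]funext do rewrite big_ord1 mxE.
apply => b; rewrite -[nrm x]mulr1 rmorphM rmorph1; apply: gram_bounded_mul => //.
- by rewrite -(rmorph0 (real_complex R)) lecR nrm_ge0.
- by rewrite -rmorphXn; exact: gram_bounded1.
- by rewrite expr1n; exact: block_bounded.
Qed.

Local Notation H := (l2_hilbertSpace R J).

Lemma raw_op_l2 (x : E) (h : l2 R J) :
  (raw_op x h : J -> C^o) \in @square_summable R J.
Proof.
apply/asboolP; apply: le_lt_trans (raw_op_bounded x h) _.
by rewrite lte_mul_pinfty ?l2_fin// lee_fin sqr_ge0.
Qed.

Lemma raw_op_bounded_linear (x : E) :
  (fun h : H => L2 (raw_op_l2 x h) : H) \in @bounded_linear R H H.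
Proof.
apply/asboolP; split=> [a f g|].
  apply: val_inj; apply/funext => k; rewrite /= -[RHS]/(a * raw_op x f k + raw_op x g k).
  rewrite /raw_op; case: insub => [p|]; last by rewrite mulr0 addr0.
  rewrite mulr_sumr -big_split; apply: eq_bigr => q _ /=.
  by rewrite [a * _]mulrCA -mulrDr.
exists (nrm x)%:C => h; rewrite -!nrmE -rmorphM lecR.
rewrite -(@ler_pXn2r _ 2) ?nnegrE ?mulr_ge0 ?nrm_ge0// exprMn !nrm_l2_sqr.
by rewrite -lee_fin EFinM !sqnormE; exact: raw_op_bounded.
Qed.

Definition block_emb (x : E) : bdlin H H := BdLin (raw_op_bounded_linear x).

Lemma block_emb_linear : linear block_emb.
Proof.
move=> a x y; apply: val_inj; apply/funext => h; apply: val_inj; apply/funext => k.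
rewrite /= -[RHS]/(a * raw_op x h k + raw_op y h k).
rewrite /raw_op; case: insub => [p|]; last by rewrite mulr0 addr0.
rewrite mulr_sumr -big_split; apply: eq_bigr => q _ /=.
by rewrite linearPl mulrDl mulrA.
Qed.

HB.instance Definition _ :=
  GRing.isLinear.Build R[i] E (bdlin H H) *:%R block_emb block_emb_linear.

Lemma sum_block_emb n (x : 'I_n -> E) (h : 'I_n -> H) (k : J) :
  l2fun (\sum_j block_emb (x j) (h j)) k = \sum_j raw_op (x j) (h j) k.
Proof.
have S (r : seq 'I_n) : l2fun (\sum_(j <- r) block_emb (x j) (h j)) k =
    \sum_(j <- r) raw_op (x j) (h j) k.
  by elim: r => [|j r IH]; rewrite ?big_nil// !big_cons -IH.
exact: S.
Qed.

(** One direction is Haagerup's inequality in each block. For the other, every [y] with Gram bound 1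
    is itself a block, so a bound on the direct sum bounds the Gram matrix of [x] and [y], and
    [gram_bounded_dual] applies. *)
Lemma block_emb_le n (x : 'M[E]_n) (c : R) : 0 < c ->
  (forall h : 'I_n -> H, \sum_i nrm (\sum_j block_emb (x i j) (h j)) ^+ 2 <=
    c ^+ 2 * \sum_i nrm (h i) ^+ 2) <-> gram_bounded ip x x (c ^+ 2)%:C.
Proof.
move=> c0.
have hE (h : 'I_n -> H) : (\sum_i nrm (h i) ^+ 2)%:E = (\sum_i sqsum (h i))%E.
  by rewrite -sumEFin; apply: eq_bigr => i _; rewrite nrm_l2_sqr sqnormE.
have eE (h : 'I_n -> H) : (\sum_i nrm (\sum_j block_emb (x i j) (h j)) ^+ 2)%:E =
    (\sum_i sqsum (fun k => (\sum_j raw_op (x i j) (h j) k)%R))%E.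
  rewrite hE; apply: eq_bigr => i _; congr sqsum.
  by apply/funext => k; exact: sum_block_emb.
split=> [xc|xc h]; last first.
  rewrite -lee_fin EFinM eE hE; apply: raw_op_le => b.
  rewrite -[c]mulr1 rmorphM rmorph1; apply: gram_bounded_mul => //.
  - by rewrite -(rmorph0 (real_complex R)) lecR ltW.
  - by rewrite -rmorphXn.
  - by rewrite expr1n; exact: block_bounded.
apply: gram_bounded_dual => // m y y1; apply: gram_bounded_sym.
pose b0 : {classic block} := Block y1.
apply/gram_boundedE => A.
(* The rows of [A] are placed in the block [b0] and extended by zero, which keeps the total squared
   norm [fro2R A]. *)
pose hA j : J -> C^o := fun k =>
  if k.1 == b0 then if insub k.2 is Some q then A j q else 0 else 0.
have hAE b : (\sum_j rsum (fun p => nrm (hA j (b, p) : C) ^+ 2)%R =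
    if b \in [set b0] then (fro2R A)%:E else 0)%E.
  have [->|bb0] := pselect (b = b0); [rewrite mem_set//|rewrite memNset//].
    rewrite /fro2R -sumEFin; apply: eq_bigr => j _.
    rewrite (@rsum_ord _ m).
    - congr (_%:E); apply: eq_bigr => q _; rewrite /hA /= eqxx.
      by rewrite (_ : insub (val q) = Some q) ?valK.
    - by move=> p; exact: sqr_ge0.
    - move=> p mp; rewrite /hA /= eqxx insubF ?ltnNge ?mp//.
      by rewrite /nrm normr0 expr0n.
  rewrite big1// => j _; rewrite /rsum esum1// => p _.
  by rewrite /hA /= (introF eqP bb0) /nrm normr0 expr0n.
have hAs : (\sum_j sqsum (hA j) = (fro2R A)%:E)%E.
  rewrite sum_sqsum; under eq_esum do rewrite hAE.
  by rewrite -esum_mkcond esum_set1// lee_fin fro2R_ge0.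
have hA2 j : hA j \in @square_summable R J.
  apply/asboolP; apply: (@le_lt_trans _ _ (\sum_j sqsum (hA j))%E).
    rewrite (bigD1 j)//= leeDl// sume_ge0// => i _; exact: sqsum_ge0.
  by rewrite hAs ltry.
have := xc (fun j => L2 (hA2 j)); rewrite -lee_fin EFinM eE hE hAs -EFinM.
rewrite -lee_fin; apply: le_trans.
(* Only the contribution of the block [b0] is kept. *)
rewrite sum_sqsum; apply: esum_ge; exists [set b0]; first by split.
rewrite fsbig_set1 raw_block lee_fin le_eqVlt; apply/orP; left; apply/eqP.
congr (fro2R (gram_mx _ _ _ _)); apply/matrixP => j q.
by rewrite mxE /= /hA /= eqxx (_ : insub (val q) = Some q) ?valK.
Qed.

Lemma opnorm_le (A : bdlin H H) (c : R) : 0 <= c ->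
  (opnorm A <= c%:E)%E <-> forall h : H, nrm (A h) <= c * nrm h.
Proof.
move=> c0.
have d1 (h : 'I_1 -> H) : dsum_norm (@nrm R H) h = nrm (h ord0).
  by rewrite /dsum_norm big_ord1 sqrtr_sqr ger0_norm ?nrm_ge0.
have -> : opnorm A = opmx_norm (@nrm R H) (const_mx (A : H -> H) : 'M[_]_1).
  congr ereal_sup; apply/seteqP; split=> [_ [h /= h1 <-]|_ [h /= h1 <-]].
    by exists (fun=> h); rewrite /= d1// big_ord1 mxE.
  by exists (h ord0); rewrite /= ?d1 ?big_ord1 ?mxE// -d1.
rewrite (opmx_norm_le (@nrm_ge0 R H) (@nrmZ_real R H) _ c0); last first.
  by move=> i j a v; rewrite mxE bdlinZ.
split=> Ah h; last first.
  by rewrite !big_ord1 mxE -exprMn ler_pXn2r ?nnegrE ?mulr_ge0 ?nrm_ge0.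
have := Ah (fun=> h); rewrite !big_ord1 mxE -exprMn.
by rewrite ler_pXn2r ?nnegrE ?mulr_ge0 ?nrm_ge0.
Qed.

(** The 1 by 1 case of [block_emb_le], where the Gram matrix is multiplication by the scalar
    [ip x x], the squared norm of [x]. *)
Lemma block_emb_isom (x : E) : opnorm (block_emb x) = (nrm x)%:E.
Proof.
apply: eq_ereal_bounds => [||c c0].
- apply: le_trans (ereal_sup_ubound _); last first.
    by exists 0 => //=; rewrite /nrm normr0.
  by rewrite lee_fin nrm_ge0.
- by rewrite lee_fin nrm_ge0.
rewrite (opnorm_le _ (ltW c0)) lee_fin.
apply: iff_trans (iff_trans (@block_emb_le 1 (const_mx x) c c0) _).
  split=> xc h; last first.
    have := xc (fun=> h); rewrite !big_ord1 mxE -exprMn.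
    by rewrite ler_pXn2r ?nnegrE ?mulr_ge0 ?nrm_ge0// ltW.
  rewrite !big_ord1 mxE -exprMn.
  by rewrite ler_pXn2r ?nnegrE ?mulr_ge0 ?nrm_ge0// ltW.
split=> [/(_ 1%:M)|xc A].
  rewrite /fro2 !big_ord1 mxE !big_ord1 !mxE normrM exprMn ip_norm normrX normr_id.
  rewrite !mulr1n normr1 expr1n !mulr1 -nrmE -!rmorphXn lecR.
  by rewrite !ler_pXn2r ?nnegrE ?sqr_ge0 ?nrm_ge0// ltW.
apply: le_trans (gram_bounded1 x A) _; rewrite ler_wpM2r ?fro2_ge0//.
by rewrite -!rmorphXn lecR !ler_pXn2r ?nnegrE ?sqr_ge0 ?nrm_ge0// ltW.
Qed.

Definition block_operatorSpace : operatorSpace H :=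
  @OperatorSpace R H E block_emb block_emb_isom.

Lemma block_self_antidual : self_antidual block_operatorSpace.
Proof.
exists ip; apply: self_antidual_of_norm_le => n x c c0.
by rewrite (os_norm_le _ (ltW c0)); exact: block_emb_le.
Qed.

End Existence.

Theorem mainTheorem1 (R : realType) (I : Type) :
  (exists (H : hilbertSpace R) (E : operatorSpace H),
      isometric_to_ell2 I E /\ self_antidual E) /\
  (forall (H1 H2 : hilbertSpace R) (E1 : operatorSpace H1) (E2 : operatorSpace H2),
      isometric_to_ell2 I E1 -> self_antidual E1 ->
      isometric_to_ell2 I E2 -> self_antidual E2 ->
      completely_isometric (os_mxNormed E1) (os_mxNormed E2)).
Proof.
split; last exact: self_antidual_unique.
(* The space itself is [l2 R I]; the placeholder stands for the coordinates of all blocks over it,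
   on which it acts. *)
exists (l2_hilbertSpace R _), (block_operatorSpace (l2_innerProduct R I)).
by split; [exact: isometric_l2|exact: block_self_antidual].
Qed.
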